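(* Let $u_0$ be a deterministic function with $u_0\in\mathcal C^0_0(\overline{\mathcal D})$ and $u_0(x)\in[-1,1]$ for all $x\in\overline{\mathcal D}$, let $b,g$ satisfy the conditions (A1), (A2), (A3) given in the context, and let $\Phi$ be an integrator satisfying conditions (P0)--(P5) given in the context. Then, for any time-step size $\tau=T/M$ with $T\in(0,\infty)$ and $M\in\mathbb N$, the numerical solution $(u^\star_m)_{0\le m\le M}$ given by the domain preserving Lie--Trotter (DPLT) splitting scheme $u^\star_0=u_0$ and, for $m\in\{0,1,\ldots,M-1\}$, $$\begin{cases}u^\star_{m+1}(x)=\int_{\mathcal D}G_d(\tau,x,y)\,\Phi\bigl(\widetilde Z^\star_{m+1}(y)\bigr)\,\mathrm dy,\quad x\in\overline{\mathcal D},\\ \widetilde Z^\star_{m+1}(y)=\Bigl(f^\star(t_m,y,u^\star_m(y))^2\tau,\ a^\star(t_m,y,u^\star_m(y))\tau+f^\star(t_m,y,u^\star_m(y))\,\delta\beta_m,\ u^\star_m(y)\Bigr),\end{cases}$$ takes values in the domain $[-1,1]$ almost surely: $$\mathbb P\bigl(u^\star_m(x)\in[-1,1],\ \forall m\in\{0,\ldots,M\},\ \forall x\in\overline{\mathcal D}\bigr)=1.$$ Furthermore, for all $m\in\{0,\ldots,M\}$, $u^\star_m$ is almost surely continuous on $\overline{\mathcal D}$.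
   Context: $\mathbb N=\{1,2,\ldots\}$, $d\in\mathbb N$, $\mathcal D=(0,1)^d$, $\overline{\mathcal D}=[0,1]^d$, $\partial\mathcal D=\overline{\mathcal D}\setminus\mathcal D$, and $\mathcal C_0^0(\overline{\mathcal D})$ is the space of continuous functions $\overline{\mathcal D}\to\mathbb R$ vanishing on $\partial\mathcal D$. $\beta$ is a standard real-valued Brownian motion on a (filtered) probability space $(\Omega,\mathcal F,\mathbb P)$ satisfying the usual conditions. $t_m=m\tau$ and $\delta\beta_m=\beta(t_{m+1})-\beta(t_m)$. Conditions on the coefficients: $b,g:[0,\infty)\times\overline{\mathcal D}\times[-1,1]\to\mathbb R$ are continuous and (A1) $b(t,x,\pm1)=g(t,x,\pm1)=0$ for all $t\in[0,\infty)$, $x\in\overline{\mathcal D}$; (A2) for all $x\in\overline{\mathcal D}$, $u\in[-1,1]$, the maps $b(\cdot,x,u)$ and $g(\cdot,x,u)$ are H\''older continuous with exponent $\frac12$ on $[0,\infty)$, and for all $T\in(0,\infty)$ there is $C(T)\in(0,\infty)$ such that for all $s,t\in[0,T]$, $\sup_{x\in\overline{\mathcal D}}\sup_{u\in[-1,1]}\bigl(|b(t,x,u)-b(s,x,u)|+|g(t,x,u)-g(s,x,u)|\bigr)\le C(T)|t-s|^{1/2}$; (A3) for all $t,x$ the maps $b(t,x,\cdot)$ and $g(t,x,\cdot)$ are of class $\mathcal C^2$ on $[-1,1]$, the maps $\partial_u^2b,\partial_u^2g$ are continuous on $[0,\infty)\times\overline{\mathcal D}\times[-1,1]$, and for all $T\in(0,\infty)$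 there is $C(T)\in(0,\infty)$ with $\sup_{t\in[0,T]}\sup_{x\in\overline{\mathcal D}}\sup_{u\in[-1,1]}\bigl(|\partial_u^2b(t,x,u)|+|\partial_u^2g(t,x,u)|\bigr)\le C(T)$. Factorised coefficients: $\sigma(u)=(u-1)(u+1)$, and $a,f:[0,\infty)\times\overline{\mathcal D}\times[-1,1]\to\mathbb R$ are the continuous mappings such that $b(t,x,u)=a(t,x,u)\sigma(u)$ and $g(t,x,u)=f(t,x,u)\sigma(u)$ (they exist under (A1)--(A3)). Extensions to $u\in\mathbb R$: $a^\star(t,x,u)=\mathds{1}_{|u|\le1}a(t,x,u)+\mathds{1}_{|u|>1}\frac{\sin(\pi u)}{\sigma(u)}$ and $f^\star(t,x,u)=\mathds{1}_{|u|\le1}f(t,x,u)+\mathds{1}_{|u|>1}\frac{\sin(\pi u)}{\sigma(u)}$, where $\mathds 1$ denotes an indicator. Conditions on the integrator: (P0) $\Phi:[0,\infty)\times\mathbb R\times[-1,1]\to\mathbb R$, $(s,\gamma,v)\mapsto\Phi(s,\gamma,v)$, is of class $\mathcal C^3$; (P1) $\Phi(s,\gamma,v)\in[-1,1]$ for all $s\ge0,\gamma\in\mathbb R,v\in[-1,1]$; (P2) $\Phi(0,0,v)=v$ for all $v\in[-1,1]$; (P3) $\partial_\gamma\Phi(0,0,v)=\sigma(v)$ for all $v\in[-1,1]$; (P4) $\partial_s\Phi(0,0,v)+\frac12\partial_\gamma^2\Phi(0,0,v)=0$ for all $v\in[-1,1]$; (P5) there is $C\in(0,\infty)$ such that for all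 $s\ge0,\gamma\in\mathbb R,v\in[-1,1]$, $\sum_{\alpha_s+\alpha_\gamma+\alpha_v\le3}|\partial_s^{\alpha_s}\partial_\gamma^{\alpha_\gamma}\partial_v^{\alpha_v}\Phi(s,\gamma,v)|\le C e^{C(|\gamma|+s)}$. Heat kernel (homogeneous Dirichlet conditions): $e_k(\xi)=\sqrt2\sin(k\pi\xi)$ for $k\in\mathbb N$, $\xi\in[0,1]$; $e_{\underline k}(x)=\prod_{j=1}^d e_{k_j}(x_j)$ for $\underline k\in\mathbb N^d$; $G_d(t,x,y)=\sum_{\underline k\in\mathbb N^d}\exp(-\|\underline k\|^2\pi^2t)\,e_{\underline k}(x)e_{\underline k}(y)$ for $t>0$, $x,y\in\overline{\mathcal D}$, with $\|\cdot\|$ the Euclidean norm. Since $\Phi$ is only defined for $v\in[-1,1]$, the well-definedness of the recursion is part of the statement. *)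

(* Defs.v *)
From HB Require Import structures.
From mathcomp Require Import all_boot all_order all_algebra.
From mathcomp Require Import all_classical all_reals all_analysis.
Set Implicit Arguments.
Unset Strict Implicit.
Unset Printing Implicit Defensive.
Import Order.TTheory GRing.Theory Num.Theory.
Import numFieldNormedType.Exports.
Local Open Scope classical_set_scope.
Local Open Scope ring_scope.

Section lebesgue_measure_tuple.
Context {R : realType}.
Notation RT := (measurableTypeR R).

Definition cons_pair n (p : RT * n.-tuple RT) : n.+1.-tuple RT :=
  [tuple of p.1 :: p.2].

Definition uncons n (t : n.+1.-tuple RT) : RT * n.-tuple RT :=
  (thead t, [tuple of behead t]).

Lemma uncons_cons_pair n : cancel (@cons_pair n) (@uncons n).
Proof.
by move=> [x t]; rewrite /uncons /cons_pair theadE; congr pair; exact: val_inj.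
Qed.

Lemma measurable_cons_pair n : measurable_fun setT (@cons_pair n).
Proof. exact: measurable_cons. Qed.

Lemma measurable_uncons n : measurable_fun setT (@uncons n).
Proof.
apply: measurable_fun_pair; last exact: measurable_behead.
exact: measurable_tnth.
Qed.

Section step.
Variables (n : nat) (mu : {sigma_finite_measure set (n.-tuple RT) -> \bar R}).

Definition lebesgue_tuple_step : set (n.+1.-tuple RT) -> \bar R :=
  pushforward (@lebesgue_measure R \x mu)%E (@cons_pair n).

Let step0 : lebesgue_tuple_step set0 = 0%E.
Proof. by rewrite /lebesgue_tuple_step /pushforward preimage_set0 measure0. Qed.

Let step_ge0 A : (0 <= lebesgue_tuple_step A)%E.
Proof. by rewrite /lebesgue_tuple_step /pushforward measure_ge0. Qed.

Let step_sigma_additive : semi_sigma_additive lebesgue_tuple_step.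
Proof.
move=> F mF tF mUF; rewrite /lebesgue_tuple_step /pushforward preimage_bigcup.
apply: measure_semi_sigma_additive.
- by move=> k; rewrite -[X in measurable X]setTI; exact: measurable_cons_pair.
- apply/trivIsetP => /= i j _ _ ij; rewrite -preimage_setI.
  by move/trivIsetP : tF => /(_ _ _ _ _ ij) ->//; rewrite preimage_set0.
- rewrite -preimage_bigcup -[X in measurable X]setTI.
  exact: measurable_cons_pair.
Qed.

HB.instance Definition _ := isMeasure.Build _ _ _ lebesgue_tuple_step
  step0 step_ge0 step_sigma_additive.

Let step_sigma_finite : sigma_finite setT lebesgue_tuple_step.
Proof.
have /sigma_finiteP[F [TF ndF Foo]] := sigma_finiteT (@lebesgue_measure R).
have /sigma_finiteP[G [TG ndG Goo]] := sigma_finiteT mu.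
exists (fun k => @uncons n @^-1` (F k `*` G k)).
  rewrite -preimage_bigcup -[LHS](@preimage_setT _ _ (@uncons n)).
  congr (_ @^-1` _); rewrite -setXTT TF TG predeqE => -[x y]; split.
    move=> [/= [k _ Fkx] [l _ Gly]]; exists (maxn k l) => //; split.
    - by move: x Fkx; exact/subsetPset/ndF/leq_maxl.
    - by move: y Gly; exact/subsetPset/ndG/leq_maxr.
  by move=> [k _ []/= ? ?]; split; exists k.
move=> k; have [mF Fk] := Foo k; have [mG Gk] := Goo k; split.
  rewrite -[X in measurable X]setTI; apply: measurable_uncons => //.
  exact: measurableX.
rewrite /lebesgue_tuple_step /pushforward -comp_preimage.
rewrite (_ : _ \o _ = id) ?preimage_id.
  by rewrite product_measure1E// lte_mul_pinfty// ge0_fin_numE.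
by apply/funext => p /=; rewrite uncons_cons_pair.
Qed.

HB.instance Definition _ := Measure_isSigmaFinite.Build _ _ _
  lebesgue_tuple_step step_sigma_finite.

End step.

(* Lebesgue measure on R^n, for the product Borel sigma-algebra carried by
   n.-tuple: the unit mass on R^0, then lambda^(n+1) = lambda \x lambda^n
   read through R * R^n = R^(n+1). *)
Fixpoint lebesgue_tuple n :
    {sigma_finite_measure set (n.-tuple RT) -> \bar R} :=
  match n with
  | 0 => \d_([tuple] : 0.-tuple RT)
  | m.+1 => lebesgue_tuple_step (lebesgue_tuple m)
  end.

End lebesgue_measure_tuple.

Section domain.
Context {R : realType}.
Implicit Types d : nat.

Definition cubeO d : set 'rV[R]_d := [set x | forall j, 0 < x ord0 j < 1].

Definition cubeC d : set 'rV[R]_d := [set x | forall j, 0 <= x ord0 j <= 1].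

Definition cube_bd d : set 'rV[R]_d := @cubeC d `\` @cubeO d.

Definition row_of_tuple d (t : d.-tuple (measurableTypeR R)) : 'rV[R]_d :=
  \row_j tnth t j.

Definition cube_tuple d : set (d.-tuple (measurableTypeR R)) :=
  @row_of_tuple d @^-1` @cubeO d.

End domain.
Arguments cubeO {R} d.
Arguments cubeC {R} d.
Arguments cube_bd {R} d.
Arguments cube_tuple {R} d.

Section calculus.
Context {R : realType}.

Section within.
Variable V : normedModType R.
Implicit Types (D : set V) (f : V -> R).

Definition quotient_in D f (a v : V) (h : R) : R := h^-1 * (f (h *: v + a) - f a).

(* Directional derivatives of f : D -> R, where D may contain boundary points:
   the increment h is restricted to a + h v \in D, which gives one-sided
   derivatives at the boundary and the usual ones at interior points. *)
Definition derivable_in D f (a v : V) : Prop :=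
  cvg (quotient_in D f a v @ within [set h | D (h *: v + a)] 0^').

Definition derive_in D (v : V) f (a : V) : R :=
  lim (quotient_in D f a v @ within [set h | D (h *: v + a)] 0^').

(* Class C^n on D, with respect to a list dirs of basis vectors: all iterated
   partial derivatives of order <= n, taken in any order, exist and are
   continuous on D. *)
Fixpoint class_C (dirs : seq V) D (n : nat) f : Prop :=
  {within D, continuous f} /\
  match n with
  | 0 => True
  | m.+1 => forall v, v \in dirs -> (forall a, D a -> derivable_in D f a v) /\
                                    class_C dirs D m (derive_in D v f)
  end.

End within.

Definition uncurry3 (A B C E : Type) (f : A -> B -> C -> E) (p : A * B * C) : E :=
  f p.1.1 p.1.2 p.2.

End calculus.

Section brownian_motion.
Context {R : realType} {dsp : measure_display} {Omega : measurableType dsp}.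
Implicit Types (P : probability Omega R) (F : R -> set_system Omega)
  (beta : R -> Omega -> R).

Definition filtration F : Prop :=
  [/\ forall t : R, 0 <= t -> sigma_algebra setT (F t),
      forall t : R, 0 <= t -> F t `<=` measurable &
      forall s t : R, 0 <= s -> s <= t -> F s `<=` F t].

(* As F 0 consists of measurable sets, the first clause entails that P is
   complete. *)
Definition usual_conditions P F : Prop :=
  [/\ filtration F,
      P.-negligible `<=` F 0 &
      forall t : R, 0 <= t -> \bigcap_(s in [set s | t < s]) F s = F t].

Definition standard_brownian_motion P F beta : Prop :=
  [/\ forall (t : R) (B : set R), 0 <= t -> measurable B -> F t (beta t @^-1` B),
      {ae P, forall w, beta 0 w = 0},
      {ae P, forall w, {within `[0, +oo[, continuous (beta ^~ w)}},
      forall (s t : R) (B : set R), 0 <= s -> s < t -> measurable B ->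
        P ((beta t \- beta s) @^-1` B) = normal_prob 0 (Num.sqrt (t - s)) B &
      forall (s t : R) (A : set Omega) (B : set R), 0 <= s -> s < t ->
        F s A -> measurable B ->
        P (A `&` (beta t \- beta s) @^-1` B) =
          (P A * P ((beta t \- beta s)%R @^-1` B))%E].

End brownian_motion.

Section coefficients.
Context {R : realType} {d : nat}.
Implicit Types (a b f g : R -> 'rV[R]_d -> R -> R).

Definition sigma (u : R) : R := (u - 1) * (u + 1).

Definition coef_dom : set (R * 'rV[R]_d * R) :=
  `[0, +oo[ `*` cubeC d `*` `[-1, 1].

(* [-1, 1] as a subset of the line seen as a normed module. *)
Definition I11 : set R^o := `[-1, 1].

Definition du2 b (t : R) (x : 'rV[R]_d) (u : R) : R :=
  derive_in I11 1 (derive_in I11 1 (b t x)) u.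

Record coef_conditions b g : Prop := CoefConditions {
  coef_continuous : {within coef_dom, continuous (uncurry3 b)} /\
                    {within coef_dom, continuous (uncurry3 g)} ;
  coef_A1 : forall (t : R) x, 0 <= t -> cubeC d x ->
    [/\ b t x (-1) = 0, b t x 1 = 0, g t x (-1) = 0 & g t x 1 = 0] ;
  coef_A2_holder : forall x (u : R), cubeC d x -> -1 <= u <= 1 ->
    exists2 L : R, 0 < L & forall s t : R, 0 <= s -> 0 <= t ->
      `|b t x u - b s x u| <= L * `|t - s| `^ (1 / 2) /\
      `|g t x u - g s x u| <= L * `|t - s| `^ (1 / 2) ;
  coef_A2_unif : forall T : R, 0 < T -> exists2 C : R, 0 < C &
    forall (s t : R) x (u : R), 0 <= s <= T -> 0 <= t <= T -> cubeC d x -> -1 <= u <= 1 ->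
      `|b t x u - b s x u| + `|g t x u - g s x u| <= C * `|t - s| `^ (1 / 2) ;
  coef_A3_C2 : forall (t : R) x, 0 <= t -> cubeC d x ->
    class_C [:: (1 : R^o)] I11 2 (b t x) /\ class_C [:: (1 : R^o)] I11 2 (g t x) ;
  coef_A3_continuous : {within coef_dom, continuous (uncurry3 (du2 b))} /\
                       {within coef_dom, continuous (uncurry3 (du2 g))} ;
  coef_A3_unif : forall T : R, 0 < T -> exists2 C : R, 0 < C &
    forall (t : R) x (u : R), 0 <= t <= T -> cubeC d x -> -1 <= u <= 1 ->
      `|du2 b t x u| + `|du2 g t x u| <= C }.

(* a is the continuous factor of b: b = a * sigma.  Continuity determines a
   at u = -1 and u = 1, hence on all of coef_dom. *)
Definition sigma_factor b a : Prop :=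
  {within coef_dom, continuous (uncurry3 a)} /\
  forall (t : R) x (u : R), 0 <= t -> cubeC d x -> -1 <= u <= 1 ->
    b t x u = a t x u * sigma u.

Definition star a (t : R) (x : 'rV[R]_d) (u : R) : R :=
  if `|u| <= 1 then a t x u else sin (pi * u) / sigma u.

End coefficients.

Section integrator.
Context {R : realType}.
Notation R3 := (R^o * R^o * R^o)%type.

Definition dir_s : R3 := (1, 0, 0).
Definition dir_gamma : R3 := (0, 1, 0).
Definition dir_v : R3 := (0, 0, 1).

Definition integrator_dom : set R3 := `[0, +oo[ `*` setT `*` `[-1, 1].

Definition dPhi (ks kg kv : nat) (Phi : R -> R -> R -> R) : R3 -> R :=
  iter ks (derive_in integrator_dom dir_s)
    (iter kg (derive_in integrator_dom dir_gamma)
      (iter kv (derive_in integrator_dom dir_v) (uncurry3 Phi))).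

Record integrator (Phi : R -> R -> R -> R) : Prop := Integrator {
  integrator_P0 :
    class_C [:: dir_s; dir_gamma; dir_v] integrator_dom 3 (uncurry3 Phi) ;
  integrator_P1 : forall s gam v : R, 0 <= s -> -1 <= v <= 1 ->
    -1 <= Phi s gam v <= 1 ;
  integrator_P2 : forall v : R, -1 <= v <= 1 -> Phi 0 0 v = v ;
  integrator_P3 : forall v : R, -1 <= v <= 1 -> dPhi 0 1 0 Phi (0, 0, v) = sigma v ;
  integrator_P4 : forall v : R, -1 <= v <= 1 ->
    dPhi 1 0 0 Phi (0, 0, v) + 1 / 2 * dPhi 0 2 0 Phi (0, 0, v) = 0 ;
  integrator_P5 : exists2 C : R, 0 < C &
    forall s gam v : R, 0 <= s -> -1 <= v <= 1 ->
      \sum_(k : 'I_4 * 'I_4 * 'I_4 | (k.1.1 + k.1.2 + k.2 <= 3)%N)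
        `|dPhi k.1.1 k.1.2 k.2 Phi (s, gam, v)|
      <= C * expR (C * (`|gam| + s)) }.

End integrator.

Section heat_kernel.
Context {R : realType}.

Definition eigenfun1 (k : nat) (xi : R) : R :=
  Num.sqrt 2 * sin (k%:R * pi * xi).

Definition eigenfun d (k : 'I_d -> nat) (x : 'rV[R]_d) : R :=
  \prod_(j < d) eigenfun1 (k j) (x ord0 j).

(* The absolutely convergent series over the multi-indices with entries in
   {1, 2, ...} is the limit of its partial sums over {1, ..., N}^d; the finite
   function k takes values in {0, ..., N - 1}, whence the successors. *)
Definition heat_kernel d (t : R) (x y : 'rV[R]_d) : R :=
  limn (fun N : nat => \sum_(k : {ffun 'I_d -> 'I_N})
    let k1 j := (k j).+1 in
    expR (- (\sum_(j < d) (k1 j)%:R ^+ 2) * pi ^+ 2 * t) *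
      eigenfun k1 x * eigenfun k1 y).

End heat_kernel.

Section scheme.
Context {R : realType} {d : nat} {Omega : Type}.
Variables (a f : R -> 'rV[R]_d -> R -> R) (Phi : R -> R -> R -> R)
  (u0 : 'rV[R]_d -> R) (tau : R) (beta : R -> Omega -> R).

Definition time (m : nat) : R := m%:R * tau.

Definition dbeta (m : nat) (w : Omega) : R :=
  beta (time m.+1) w - beta (time m) w.

(* The argument of Phi at step m, as a function of the current value
   u of the numerical solution at y. *)
Definition Zarg (m : nat) (w : Omega) (y : 'rV[R]_d) (u : R) : R * R * R :=
  (star f (time m) y u ^+ 2 * tau,
   star a (time m) y u * tau + star f (time m) y u * dbeta m w,
   u).

Definition dplt_integrand (m : nat) (w : Omega) (um : 'rV[R]_d -> R)
    (x y : 'rV[R]_d) : R :=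
  heat_kernel tau x y * uncurry3 Phi (Zarg m w y (um y)).

Fixpoint dplt (m : nat) (w : Omega) : 'rV[R]_d -> R :=
  match m with
  | 0 => u0
  | n.+1 => fun x => \int[lebesgue_tuple d]_(y in cube_tuple d)
      dplt_integrand n w (dplt n w) x (row_of_tuple y)
  end.

(* Phi is represented by a total function whose values outside integrator_dom
   are arbitrary, and the integral is a total operator: step m is meaningful
   when Phi is only evaluated inside its domain and the integrand defining
   u_{m+1}(x) is integrable. *)
Definition dplt_step_well_defined (m : nat) (w : Omega) : Prop :=
  (forall y, cubeO d y -> integrator_dom (Zarg m w y (dplt m w y))) /\
  (forall x, cubeC d x -> (lebesgue_tuple d).-integrable (cube_tuple d)
     (fun y => (dplt_integrand m w (dplt m w) x (row_of_tuple y))%:E)).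

End scheme.

(* Main.v *)
Require Import Defs.
From HB Require Import structures.
From mathcomp Require Import all_boot all_order all_algebra.
From mathcomp Require Import all_classical all_reals all_analysis.
From mathcomp Require Import measurable_realfun ring lra zify.
Set Implicit Arguments.
Unset Strict Implicit.
Unset Printing Implicit Defensive.
Import Order.TTheory GRing.Theory Num.Theory.
Import numFieldNormedType.Exports.
Local Open Scope classical_set_scope.
Local Open Scope ring_scope.

(** All the assertions hold for every path w, by induction on the time step: if u_m is
    continuous on the closed cube with values in [-1, 1], then so is u_(m+1).  While u_m
    stays in [-1, 1], the starred coefficients are the continuous factors a and f, the
    argument of Phi lies in its domain, and y |-> Phi (Z (y)) is continuous on the closed
    cube and bounded by 1 because Phi takes values in [-1, 1].  Hence u_(m+1) is the image
    of a measurable function bounded by 1 under the Dirichlet heat semigroup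
    ([splitting_step]), and three facts about the kernel G finish the step: G >= 0, the
    integral of G (x, .) over the cube is at most 1, and G is Lipschitz in x uniformly
    in y.

    Since exp (- |k|^2 pi^2 t) factors, G is a product of one-dimensional kernels
    ([heat_kernelE]), and Tonelli reduces everything to dimension one, where with
    q = exp (- pi^2 t) the kernel is the difference K (x - y) - K (x + y) for
    K (z) = 1/2 + sum_(k >= 1) q^(k^2) cos (k pi z).  The Lipschitz bound comes from
    differentiating the series.

    The other two facts come from the Jacobi triple product: up to a positive constant,
    K (z) is the product over k of the factors 1 + 2 q^(2k-1) cos (pi z) + q^(4k-2), each nonnegative and increasing in
    cos (pi z).  As cos (pi (x - y)) >= cos (pi (x + y)) on the unit square, this yields
    K (x - y) >= K (x + y), that is G >= 0 ([dirichlet_kernel_ge0]).  As K >= 0, it also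
    yields G <= K (x - y) + K (x + y), the Neumann kernel, whose integral in y is 1
    ([integral_dirichlet_kernel_le1]).

    Infinite products are avoided: the product with n factors equals, by an exact identity
    ([theta_rec]), a cosine polynomial with Gaussian binomial coefficients, and its
    coefficients differ from the q^(j^2) by O (q^(2n)) ([theta_coef_error]).  Each
    inequality for K is thus an inequality for finite sums with an error O (q^n). *)

(** * Finite Jacobi triple product *)

Section finite_theta.
Context {R : realType}.
Variable q : R.
Hypothesis q01 : 0 < q < 1.
Let q_gt0 : 0 < q. Proof. by case/andP: q01. Qed.
Let q_ge0 : 0 <= q. Proof. exact: ltW. Qed.
Let q_lt1 : q < 1. Proof. by case/andP: q01. Qed.

Lemma subr1X_gt0 n : (0 < n)%N -> 0 < 1 - q ^+ n.
Proof. by move=> n0; rewrite subr_gt0 exprn_ilt1 // -lt0n. Qed.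

(** The finite form of the Jacobi triple product is
      prod_(1 <= k <= n) (1 + 2 q^(2k-1) cos z + q^(4k-2))
        = sum_(-n <= j <= n) [2n choose n+j]_(q^2) q^(j^2) cos (j z).
    Dividing by the constant term leaves the coefficients [theta_coef q n j],
    and [theta_ratio] is the quotient of two consecutive ones.  Natural-number
    subtraction makes it vanish at i = n, so the coefficients beyond n are 0
    without a side condition. *)
Definition theta_ratio n i : R :=
  q ^+ (2 * i + 1) * ((1 - q ^+ (2 * (n - i))) / (1 - q ^+ (2 * (n + i + 1)))).

Definition theta_coef n j : R := \prod_(i < j) theta_ratio n i.

Lemma theta_coefS n j : theta_coef n j.+1 = theta_coef n j * theta_ratio n j.
Proof. by rewrite /theta_coef big_ord_recr. Qed.

Lemma theta_coef0 n : theta_coef n 0 = 1.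
Proof. by rewrite /theta_coef big_ord0. Qed.

Lemma theta_coef_gt n j : (n < j)%N -> theta_coef n j = 0.
Proof.
elim: j => // j IH; rewrite ltnS leq_eqVlt theta_coefS => /orP[/eqP <-|/IH ->].
  by rewrite /theta_ratio subnn muln0 expr0 subrr mul0r !mulr0.
by rewrite mul0r.
Qed.

(** Telescoping in j: passing from n to n + 1 changes each ratio by factors that
    cancel between consecutive indices. *)
Lemma theta_coef_step n j : (j <= n)%N ->
  theta_coef n.+1 j * ((1 - q ^+ (2 * (n.+1 - j))) * (1 - q ^+ (2 * (n.+1 + j)))) =
  theta_coef n j * (1 - q ^+ (2 * n.+1)) ^+ 2.
Proof.
elim: j => [_|j IH jn]; first by rewrite !theta_coef0 subn0 addn0 expr2.
have {IH} := IH (ltnW jn).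
rewrite !theta_coefS /theta_ratio.
have -> : (n.+1 - j.+1 = n - j)%N by [].
have -> : (n.+1 + j + 1 = n.+1 + j.+1)%N by lia.
have -> : (n + j + 1 = n.+1 + j)%N by lia.
have h1 : 0 < 1 - q ^+ (2 * (n - j)) by apply: subr1X_gt0; lia.
have h2 : 0 < 1 - q ^+ (2 * (n.+1 + j)) by apply: subr1X_gt0; lia.
have h3 : 0 < 1 - q ^+ (2 * (n.+1 + j.+1)) by apply: subr1X_gt0; lia.
set a := 1 - q ^+ (2 * (n.+1 - j)).
set b := 1 - _ in h2 *; set b2 := 1 - _ in h3 *; set h := 1 - _ in h1 *.
move=> E.
have -> : theta_coef n.+1 j * (q ^+ (2 * j + 1) * (a / b2)) * (h * b2) =
   theta_coef n.+1 j * (a * b) * (q ^+ (2 * j + 1) * h / b).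
  by field; rewrite !gt_eqF.
by rewrite E; field; rewrite gt_eqF.
Qed.

(** The constant term of the product with n + 1 factors, divided by the one of the
    product with n factors. *)
Definition theta_norm n : R :=
  (1 - q ^+ (2 * (2 * n) + 2)) * (1 - q ^+ (2 * (2 * n) + 4)) /
  (1 - q ^+ (2 * n.+1)) ^+ 2.

Lemma theta_norm_gt0 n : 0 < theta_norm n.
Proof.
by rewrite /theta_norm divr_gt0 ?mulr_gt0 ?exprn_gt0 ?subr1X_gt0 // addnS.
Qed.

Local Ltac merge_powers :=
  by rewrite -!exprM -?exprD -?exprD -?exprSr; congr (_ ^+ _); lia.

(** Comparison of the coefficients of cos (0 z) when the product receives the
    factor of index n + 1. *)
Lemma theta_coef_rec0 n : theta_norm n =
  1 + q ^+ (4 * n + 2) + 2 * q ^+ (2 * n + 1) * theta_coef n 1.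
Proof.
rewrite /theta_norm theta_coefS theta_coef0 mul1r /theta_ratio subn0.
have -> : (2 * (n + 0 + 1) = 2 * n.+1)%N by lia.
have : 0 < 1 - q ^+ (2 * n.+1) by apply: subr1X_gt0.
have -> : q ^+ (2 * n.+1) = (q ^+ n) ^+ 2 * q ^+ 2
  by merge_powers.
have -> : q ^+ (2 * (2 * n) + 2) = (q ^+ n) ^+ 4 * q ^+ 2
  by merge_powers.
have -> : q ^+ (2 * (2 * n) + 4) = (q ^+ n) ^+ 4 * q ^+ 4
  by merge_powers.
have -> : q ^+ (4 * n + 2) = (q ^+ n) ^+ 4 * q ^+ 2
  by merge_powers.
have -> : q ^+ (2 * n + 1) = (q ^+ n) ^+ 2 * q
  by merge_powers.
have -> : q ^+ (2 * n) = (q ^+ n) ^+ 2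
  by merge_powers.
rewrite muln0 add0n expr1.
move: (q ^+ n) => Y H.
by field; apply: lt0r_neq0; lra.
Qed.

(** Comparison of the coefficients of cos ((j + 1) z), the Pascal identity of the
    Gaussian binomials; the cases j = n and j > n are degenerate because some of
    the three neighbours vanish. *)
Lemma theta_coef_recS n j : theta_norm n * theta_coef n.+1 j.+1 =
  (1 + q ^+ (4 * n + 2)) * theta_coef n j.+1
  + q ^+ (2 * n + 1) * (theta_coef n j + theta_coef n j.+2).
Proof.
have [jn|nj|->] := ltngtP j n; last first.
- rewrite [theta_coef n n.+1]theta_coef_gt // [theta_coef n n.+2]theta_coef_gt //.
  rewrite mulr0 add0r addr0.
  rewrite theta_coefS.
  have := theta_coef_step (leqnn n).
  rewrite /theta_norm /theta_ratio.
  have -> : (n.+1 - n = 1)%N by lia.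
  have -> : (n.+1 + n = 2 * n + 1)%N by lia.
  have -> : (2 * n + 1 + 1 = 2 * n + 2)%N by lia.
  have -> : (2 * (2 * n + 1) = 2 * (2 * n) + 2)%N by lia.
  have -> : (2 * (2 * n + 2) = 2 * (2 * n) + 4)%N by lia.
  have h1 : 0 < 1 - q ^+ (2 * (2 * n) + 2) by rewrite subr1X_gt0 // addnS.
  have h2 : 0 < 1 - q ^+ (2 * (2 * n) + 4) by rewrite subr1X_gt0 // addnS.
  have h3 : 0 < 1 - q ^+ (2 * n.+1) by rewrite subr1X_gt0.
  set a := 1 - q ^+ (2 * 1); set s := 1 - q ^+ (2 * n.+1) in h3 *.
  set b := 1 - _ in h1 *; set b2 := 1 - _ in h2 *.
  move=> E.
  have -> : b * b2 / s ^+ 2 *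
      (theta_coef n.+1 n * (q ^+ (2 * n + 1) * (a / b2))) =
      theta_coef n.+1 n * (a * b) * (q ^+ (2 * n + 1) / s ^+ 2).
    by field; rewrite !gt_eqF.
  by rewrite E; field; rewrite gt_eqF.
- have [n1 n2] : (n < j.+1)%N /\ (n < j.+2)%N by lia.
  rewrite (theta_coef_gt nj) (theta_coef_gt n1) (theta_coef_gt n2).
  by rewrite (@theta_coef_gt n.+1 j.+1) // !(addr0, mulr0).
have := theta_coef_step jn.
rewrite (theta_coefS n j.+1) (theta_coefS n j) /theta_norm /theta_ratio.
have [k ->] : exists k, n = (j + k.+1)%N by exists (n - j.+1)%N; lia.
set c := theta_coef _.+1 _; set c0 := theta_coef _ _.
have h1 : 0 < 1 - q ^+ (2 * ((j + k.+1).+1 - j.+1)) by apply: subr1X_gt0; lia.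
have h2 : 0 < 1 - q ^+ (2 * ((j + k.+1).+1 + j.+1)) by apply: subr1X_gt0; lia.
have h3 : 0 < 1 - q ^+ (2 * (j + k.+1).+1) by apply: subr1X_gt0; lia.
have h4 : 0 < 1 - q ^+ (2 * (j + k.+1 + j.+1 + 1)) by apply: subr1X_gt0; lia.
have h5 : 0 < 1 - q ^+ (2 * (j + k.+1 + j + 1)) by apply: subr1X_gt0; lia.
move: h1 h2 h3 h4 h5.
have -> : q ^+ (2 * (j + k.+1).+1) = (q ^+ j) ^+ 2 * (q ^+ k) ^+ 2 * q ^+ 4
  by merge_powers.
have -> : q ^+ (2 * ((j + k.+1).+1 - j.+1)) = (q ^+ k) ^+ 2 * q ^+ 2
  by merge_powers.
have -> : q ^+ (2 * ((j + k.+1).+1 + j.+1)) = (q ^+ j) ^+ 4 * (q ^+ k) ^+ 2 * q ^+ 6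
  by merge_powers.
have -> : q ^+ (2 * (j + k.+1 + j.+1 + 1)) = (q ^+ j) ^+ 4 * (q ^+ k) ^+ 2 * q ^+ 6
  by merge_powers.
have -> : q ^+ (2 * (j + k.+1 + j + 1)) = (q ^+ j) ^+ 4 * (q ^+ k) ^+ 2 * q ^+ 4
  by merge_powers.
have -> : q ^+ (2 * (2 * (j + k.+1)) + 2) = (q ^+ j) ^+ 4 * (q ^+ k) ^+ 4 * q ^+ 6
  by merge_powers.
have -> : q ^+ (2 * (2 * (j + k.+1)) + 4) = (q ^+ j) ^+ 4 * (q ^+ k) ^+ 4 * q ^+ 8
  by merge_powers.
have -> : q ^+ (4 * (j + k.+1) + 2) = (q ^+ j) ^+ 4 * (q ^+ k) ^+ 4 * q ^+ 6
  by merge_powers.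
have -> : q ^+ (2 * (j + k.+1) + 1) = (q ^+ j) ^+ 2 * (q ^+ k) ^+ 2 * q ^+ 3
  by merge_powers.
have -> : q ^+ (2 * (j + k.+1 - j.+1)) = (q ^+ k) ^+ 2
  by merge_powers.
have -> : q ^+ (2 * j.+1 + 1) = (q ^+ j) ^+ 2 * q ^+ 3
  by merge_powers.
have -> : q ^+ (2 * j + 1) = (q ^+ j) ^+ 2 * q
  by merge_powers.
move: (q ^+ j) (q ^+ k) => X Z.
(* Everything is a rational function of q, X = q^j and Z = q^k; the polynomial
   identity K is separated from the division by the nonzero factors a, b, e, s. *)
set p1 := 1 - X ^+ 4 * Z ^+ 4 * q ^+ 6; set p2 := 1 - X ^+ 4 * Z ^+ 4 * q ^+ 8.
set A := 1 + X ^+ 4 * Z ^+ 4 * q ^+ 6; set B := _ * q ^+ 3; set r1 := X ^+ 2 * q.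
set r2 := X ^+ 2 * q ^+ 3.
set a := 1 - Z ^+ 2 * q ^+ 2; set b := 1 - _ * q ^+ 6; set s := 1 - _.
set e := 1 - _; set h := 1 - _ => ha hb hs _ he E.
have K : p1 * p2 * r1 = A * r1 * a * b + B * (b * e + r1 * r2 * a * h).
  by rewrite /p1 /p2 /A /B /r1 /r2 /a /b /e /h; ring.
move: p1 p2 A B r1 r2 a b s e h ha hb hs he E K => p1 p2 A B r1 r2 a b s e h.
move=> ha hb hs he E K.
have -> : p1 * p2 / s ^+ 2 * c = c * (a * b) * (p1 * p2 / (s ^+ 2 * a * b)).
  by field; rewrite !gt_eqF.
rewrite E.
have -> : c0 * (r1 * (a / e)) * s ^+ 2 * (p1 * p2 / (s ^+ 2 * a * b)) =
    p1 * p2 * r1 * (c0 / (b * e)) by field; rewrite !gt_eqF.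
by rewrite K; field; rewrite !gt_eqF.
Qed.
End finite_theta.

Section theta_function.
Context {R : realType}.
Implicit Types (q z x y : R) (n j : nat).

(** Up to a positive factor this is the n-fold product
    prod_k (1 + 2 q^(2k-1) cos z + q^(4k-2)), by [theta_rec]; as n grows it tends to
    1 + 2 sum_j q^(j^2) cos (j z). *)
Definition theta q n z : R :=
  1 + 2 * \sum_(j < n) theta_coef q n j.+1 * cos (j.+1%:R * z).

Lemma cosM_cosX j z :
  2 * cos z * cos (j.+1%:R * z) = cos (j%:R * z) + cos (j.+2%:R * z).
Proof.
have -> : j%:R * z = j.+1%:R * z - z by rewrite -[in RHS]natr1; ring.
have -> : j.+2%:R * z = j.+1%:R * z + z by rewrite -[in LHS]natr1; ring.
by rewrite cosB cosD; ring.
Qed.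

Lemma cos_polyM (c : nat -> R) n a b z : c 0 = 1 -> c n.+1 = 0 -> c n.+2 = 0 ->
  (a + 2 * b * cos z) * (1 + 2 * \sum_(j < n) c j.+1 * cos (j.+1%:R * z)) =
  a + 2 * b * c 1 +
  2 * \sum_(j < n.+1) (a * c j.+1 + b * (c j + c j.+2)) * cos (j.+1%:R * z).
Proof.
move=> c0 cn1 cn2.
have E1 : \sum_(j < n) c j.+1 * cos (j%:R * z) =
    c 1 + \sum_(j < n.+1) c j.+2 * cos (j.+1%:R * z).
  transitivity (\sum_(j < n.+2) c j.+1 * cos (j%:R * z)); last first.
    by rewrite big_ord_recl /= mul0r cos0 mulr1.
  by rewrite !big_ord_recr /= cn1 cn2 !mul0r !addr0.
have E2 : \sum_(j < n.+1) c j * cos (j.+1%:R * z) =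
    cos z + \sum_(j < n) c j.+1 * cos (j.+2%:R * z).
  by rewrite big_ord_recl c0 /= mul1r mul1r.
have E3 : \sum_(j < n.+1) c j.+1 * cos (j.+1%:R * z) =
    \sum_(j < n) c j.+1 * cos (j.+1%:R * z).
  by rewrite big_ord_recr /= cn1 mul0r addr0.
have E4 : 2 * cos z * \sum_(j < n) c j.+1 * cos (j.+1%:R * z) =
    \sum_(j < n) c j.+1 * cos (j%:R * z) + \sum_(j < n) c j.+1 * cos (j.+2%:R * z).
  rewrite mulr_sumr -big_split /=; apply: eq_bigr => j _.
  by rewrite mulrCA cosM_cosX mulrDr.
have -> : \sum_(j < n.+1) (a * c j.+1 + b * (c j + c j.+2)) * cos (j.+1%:R * z) =
   a * (\sum_(j < n.+1) c j.+1 * cos (j.+1%:R * z)) +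
   b * ((\sum_(j < n.+1) c j * cos (j.+1%:R * z)) +
        (\sum_(j < n.+1) c j.+2 * cos (j.+1%:R * z))).
  rewrite -big_split !mulr_sumr -big_split /=; apply: eq_bigr => j _; ring.
rewrite E3 E2.
move: E4; rewrite E1.
set S := \sum_(_ < _) _; set T := \sum_(_ < _.+1) _; set U := \sum_(_ < _) _.
move=> E4.
have -> : (a + 2 * b * cos z) * (1 + 2 * S) =
  a + 2 * b * cos z + 2 * a * S + 2 * b * (2 * cos z * S) by ring.
by rewrite E4; ring.
Qed.

Lemma theta_rec q n z : 0 < q < 1 -> theta_norm q n * theta q n.+1 z =
  (1 + q ^+ (4 * n + 2) + 2 * q ^+ (2 * n + 1) * cos z) * theta q n z.
Proof.
move=> q01; rewrite /theta (@cos_polyM (theta_coef q n)); first last.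
- by rewrite theta_coef_gt.
- by rewrite theta_coef_gt.
- by rewrite theta_coef0.
rewrite -theta_coef_rec0 // mulrDr mulr1; congr (_ + _).
rewrite mulrCA; congr (_ * _); rewrite mulr_sumr; apply: eq_bigr => j _.
by rewrite mulrA theta_coef_recS.
Qed.

(** Every factor of the product is nonnegative, because it is at least
    1 + p^2 - 2 p = (1 - p)^2, and nondecreasing in cos z. *)
Lemma theta_mono q n z z' : 0 < q < 1 -> cos z <= cos z' ->
  0 <= theta q n z <= theta q n z'.
Proof.
move=> q01 zz'; elim: n => [|n IH].
  by rewrite /theta !big_ord0 mulr0 addr0 ler01 lexx.
have k0 := theta_norm_gt0 q01 n.
rewrite -(pmulr_rge0 _ k0) -[X in _ && X](ler_pM2l k0) !theta_rec //.
have q0 : 0 < q by case/andP: q01.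
have p0 : 0 <= q ^+ (2 * n + 1) by rewrite exprn_ge0 // ltW.
have -> : q ^+ (4 * n + 2) = q ^+ (2 * n + 1) ^+ 2.
  by rewrite -exprM; congr (_ ^+ _); lia.
move: (q ^+ _) p0 => p p0.
have f0 : 0 <= 1 + p ^+ 2 + 2 * p * cos z.
  have := sqr_ge0 (1 - p); have := cos_geN1 z; nra.
have f1 : 1 + p ^+ 2 + 2 * p * cos z <= 1 + p ^+ 2 + 2 * p * cos z' by nra.
case/andP: IH => IH1 IH2.
by rewrite mulr_ge0 //= ler_pM.
Qed.


Lemma exprn_anti q m n : 0 < q < 1 -> (m <= n)%N -> q ^+ n <= q ^+ m.
Proof. by move=> /andP[/ltW q0 /ltW q1]; exact: ler_wiXn2l. Qed.

(** Each quotient (1 - q^(2(n-i))) / (1 - q^(2(n+i+1))) lies between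
    1 - q^(2(n-i)) and 1, so a product of j of them differs from 1 by at most the
    sum of the deviations. *)
Lemma theta_coef_bound q n j : 0 < q < 1 -> (j <= n)%N ->
  exists D, [/\ theta_coef q n j = q ^+ (j ^ 2) * D, 0 <= D, D <= 1 &
    1 - D <= j%:R * q ^+ (2 * (n.+1 - j))].
Proof.
move=> q01; have /andP[q0 q1] := q01.
elim: j => [_|j IH jn].
  by exists 1; rewrite theta_coef0 expr0 mulr1 ler01 subrr mul0r lexx.
have [D [cD D0 D1 Dl]] := IH (ltnW jn).
set e := q ^+ (2 * (n - j)).
set e2 := q ^+ (2 * (n + j + 1)).
have e_ge0 : 0 <= e by rewrite exprn_ge0 // ltW.
have e_le1 : e <= 1 by rewrite exprn_ile1 // ltW.
have e2_ge0 : 0 <= e2 by rewrite exprn_ge0 // ltW.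
have e2e : e2 <= e by apply: exprn_anti => //; clear; lia.
have e2_lt1 : 0 < 1 - e2 by rewrite subr1X_gt0 // addn1.
have r_ge0 : 0 <= (1 - e) / (1 - e2) by rewrite divr_ge0 ?subr_ge0 // -subr_ge0 ltW.
have r_le1 : (1 - e) / (1 - e2) <= 1 by rewrite ler_pdivrMr // mul1r; lra.
have r_ge : 1 - e <= (1 - e) / (1 - e2).
  by rewrite ler_pdivlMr //; nra.
exists (D * ((1 - e) / (1 - e2))); split.
- rewrite theta_coefS cD /theta_ratio -/e -/e2.
  have -> : (j.+1 ^ 2 = j ^ 2 + (2 * j + 1))%N.
    by rewrite -[j.+1]addn1 sqrnD muln1 exp1n -addnA [(1 + _)%N]addnC.
  by rewrite [in RHS]exprD mulrACA.
- exact: mulr_ge0.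
- by rewrite mulr_ile1.
- have ee : q ^+ (2 * (n.+1 - j)) <= e by apply: exprn_anti => //; clear; lia.
  rewrite -natr1.
  have j0 : 0 <= j%:R :> R by [].
  have : D * (1 - e) <= D * ((1 - e) / (1 - e2)) by rewrite ler_wpM2l.
  have : j%:R * q ^+ (2 * (n.+1 - j)) <= j%:R * e by rewrite ler_wpM2l.
  nra.
Qed.

Lemma geometric_sum_le q n : 0 < q < 1 -> \sum_(k < n) q ^+ k <= (1 - q)^-1.
Proof.
move=> /andP[q0 q1].
have p0 : 0 < 1 - q by lra.
rewrite -[leRHS]mul1r ler_pdivlMr //.
have := subrX1 q n; have := exprn_ge0 n (ltW q0); lra.
Qed.

Lemma natrX_bound q n : 0 < q < 1 -> n%:R * q ^+ n <= (1 - q)^-1.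
Proof.
move=> q01; apply: le_trans (geometric_sum_le n q01).
rewrite mulr_natl -[n in _ *+ n]card_ord -sumr_const; apply: ler_sum => i _.
by rewrite exprn_anti // ltnW.
Qed.

(** The bound is uniform in j because the small factor q^((j+1)^2) absorbs both the
    weight j + 1 and the loss q^(-2j) in the deviation q^(2(n-j)). *)
Lemma theta_coef_error q n j : 0 < q < 1 -> (j < n)%N ->
  `|q ^+ (j.+1 ^ 2) - theta_coef q n j.+1| <= (1 - q)^-1 * (q ^+ n * q ^+ n).
Proof.
move=> q01 jn; have /andP[q0 q1] := q01.
have [D [-> D0 D1 Dl]] := theta_coef_bound q01 jn.
rewrite -{1}[q ^+ (j.+1 ^ 2)]mulr1 -mulrBr ger0_norm; last first.
  by rewrite mulr_ge0 ?exprn_ge0 ?subr_ge0 // ltW.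
apply: (@le_trans _ _ (j.+1%:R * q ^+ j.+1 * (q ^+ n * q ^+ n))); last first.
  by rewrite ler_wpM2r ?natrX_bound // mulr_ge0 // exprn_ge0 // ltW.
apply: (@le_trans _ _ (q ^+ (j.+1 ^ 2) * (j.+1%:R * q ^+ (2 * (n.+1 - j.+1))))).
  by rewrite ler_wpM2l // exprn_ge0 // ltW.
rewrite mulrCA -mulrA ler_wpM2l // -!exprD exprn_anti //.
have jj : (j <= j * j)%N by case: (j) => // k; rewrite leq_pmulr.
have -> : (j.+1 ^ 2 = j * j + 2 * j + 1)%N.
  by rewrite -[j.+1]addn1 sqrnD muln1 exp1n mulnn addnAC.
rewrite subSS; move: jn jj; clear.
by move: (j * j)%N => m; lia.
Qed.
End theta_function.

(** * The one-dimensional Dirichlet heat kernel *)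

Section dirichlet_sum.
Context {R : realType}.
Implicit Types (q z x y : R) (n j : nat).

(** Partial sum of the heat kernel of (0, 1) with Dirichlet conditions at the time t
    for which q = exp (- pi^2 t). *)
Definition dirichlet_sum q n x y : R :=
  \sum_(k < n) q ^+ (k.+1 ^ 2) * (eigenfun1 k.+1 x * eigenfun1 k.+1 y).

Lemma eigenfun1M k x y : eigenfun1 k x * eigenfun1 k y =
  cos (k%:R * (pi * (x - y))) - cos (k%:R * (pi * (x + y))).
Proof.
rewrite /eigenfun1.
have -> : k%:R * (pi * (x - y)) = k%:R * pi * x - k%:R * pi * y by ring.
have -> : k%:R * (pi * (x + y)) = k%:R * pi * x + k%:R * pi * y by ring.
rewrite cosB cosD mulrACA -expr2 sqr_sqrtr //; ring.
Qed.

(** The reflection principle at the level of finite sums: the Dirichlet kernel is the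
    periodic kernel at x - y minus the one at x + y, and the finite theta
    polynomials approximate the latter with a geometrically small error. *)
Lemma dirichlet_sum_theta q n x y : 0 < q < 1 ->
  `|dirichlet_sum q n x y -
    (theta q n (pi * (x - y)) - theta q n (pi * (x + y))) / 2|
  <= 2 * (1 - q)^-1 ^+ 2 * q ^+ n.
Proof.
move=> q01; have /andP[q0 q1] := q01.
have -> : (theta q n (pi * (x - y)) - theta q n (pi * (x + y))) / 2 =
   \sum_(k < n) theta_coef q n k.+1 * (eigenfun1 k.+1 x * eigenfun1 k.+1 y).
  rewrite /theta opprD addrACA subrr add0r -mulrBr mulrC mulKf // -sumrB.
  by apply: eq_bigr => k _; rewrite eigenfun1M [RHS]mulrBr.
rewrite /dirichlet_sum -sumrB; apply: le_trans (ler_norm_sum _ _ _) _.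
apply: (@le_trans _ _ (\sum_(k < n) 2 * (1 - q)^-1 * q ^+ n * q ^+ n)).
  apply: ler_sum => k _; rewrite -mulrBl normrM mulrC -[leRHS]mulrA -[leRHS]mulrA.
  apply: ler_pM => //.
    rewrite eigenfun1M (le_trans (ler_normB _ _)) //.
    have -> : 2 = 1 + 1 :> R by [].
    by rewrite lerD // ler_norml ?cos_geN1 ?cos_le1.
  exact: theta_coef_error.
rewrite sumr_const card_ord -[leLHS]mulr_natl.
have -> : n%:R * (2 * (1 - q)^-1 * q ^+ n * q ^+ n) =
  (2 * (1 - q)^-1) * (n%:R * q ^+ n) * q ^+ n by ring.
rewrite ler_wpM2r ?exprn_ge0 ?(ltW q0) // [in leRHS]expr2 mulrA.
have i0 : 0 <= (1 - q)^-1 by rewrite invr_ge0; lra.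
by rewrite ler_wpM2l ?mulr_ge0 ?natrX_bound.
Qed.

(** Monotonicity of theta in cos z gives the sign, because
    cos (pi (x - y)) - cos (pi (x + y)) = 2 sin (pi x) sin (pi y) >= 0. *)
Lemma dirichlet_sum_ge q n x y : 0 < q < 1 -> 0 <= x <= 1 -> 0 <= y <= 1 ->
  - (2 * (1 - q)^-1 ^+ 2 * q ^+ n) <= dirichlet_sum q n x y.
Proof.
move=> q01 x01 y01.
have := dirichlet_sum_theta n x y q01; rewrite ler_norml => /andP[+ _].
suff : theta q n (pi * (x + y)) <= theta q n (pi * (x - y)) by lra.
suff /(theta_mono n q01)/andP[_ +] : cos (pi * (x + y)) <= cos (pi * (x - y)) by [].
rewrite !mulrDr mulrN cosB cosD.
have s0 (t : R) : 0 <= t <= 1 -> 0 <= sin (pi * t).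
  move=> /andP[t0 t1]; apply: sin_ge0_pi.
  by rewrite mulr_ge0 ?pi_ge0 //= ler_piMr // pi_ge0.
have := mulr_ge0 (s0 x x01) (s0 y y01); lra.
Qed.

(** Since theta is nonnegative, replacing the difference of the two periodic kernels
    by their sum only increases the value.  The sum is a truncated Neumann kernel,
    whose integral over y is its constant term 1. *)
Lemma dirichlet_sum_le q n x y : 0 < q < 1 ->
  dirichlet_sum q n x y <= 1 +
   \sum_(k < n) 2 * theta_coef q n k.+1 * cos (k.+1%:R * pi * x) *
                cos (k.+1%:R * pi * y)
   + 2 * (1 - q)^-1 ^+ 2 * q ^+ n.
Proof.
move=> q01.
have := dirichlet_sum_theta n x y q01; rewrite ler_norml => /andP[_].
have /(theta_mono n q01)/andP[t0 _] := lexx (cos (pi * (x + y))).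
suff -> : 1 +
   \sum_(k < n) 2 * theta_coef q n k.+1 * cos (k.+1%:R * pi * x) *
                cos (k.+1%:R * pi * y) =
   (theta q n (pi * (x - y)) + theta q n (pi * (x + y))) / 2 by lra.
rewrite /theta addrACA -mulrDr -big_split /=.
rewrite -[1 + 1]/(2 : R) -[X in X + 2 * _]mulr1 -mulrDr mulrC mulKf //; congr (_ + _).
apply: eq_bigr => k _; rewrite -mulrDr.
have -> : k.+1%:R * (pi * (x - y)) = k.+1%:R * pi * x - k.+1%:R * pi * y by ring.
have -> : k.+1%:R * (pi * (x + y)) = k.+1%:R * pi * x + k.+1%:R * pi * y by ring.
by rewrite cosB cosD; ring.
Qed.
End dirichlet_sum.

Section dirichlet_kernel.
Context {R : realType}.
Implicit Types (q x y : R) (n k : nat).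

Definition dirichlet_kernel q x y : R := limn (fun n => dirichlet_sum q n x y).

Lemma eigenfun1M_norm k l x y : `|eigenfun1 k x * eigenfun1 l y : R| <= 2.
Proof.
rewrite normrM.
have H j (z : R) : `|eigenfun1 j z : R| <= Num.sqrt 2.
  rewrite /eigenfun1 normrM ger0_norm ?sqrtr_ge0 // ler_piMr ?sqrtr_ge0 //.
  by rewrite ler_norml sin_geN1 sin_le1.
apply: (le_trans (ler_pM (normr_ge0 _) (normr_ge0 _) (H _ _) (H _ _))).
by rewrite -expr2 sqr_sqrtr.
Qed.

Lemma dirichlet_sum_dist q n m x y : 0 < q < 1 -> (n <= m)%N ->
  `|dirichlet_sum q m x y - dirichlet_sum q n x y| <= 2 * (1 - q)^-1 * q ^+ n.
Proof.
move=> q01 nm; have /andP[q0 q1] := q01.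
rewrite -(subnKC nm); move: (m - n)%N => p.
rewrite /dirichlet_sum big_split_ord /= addrAC subrr add0r.
apply: le_trans (ler_norm_sum _ _ _) _.
apply: (@le_trans _ _ (\sum_(k < p) 2 * q ^+ n * q ^+ k)); last first.
  rewrite -mulr_sumr [leRHS]mulrAC ler_wpM2l ?geometric_sum_le //.
  by rewrite mulr_ge0 // exprn_ge0 // ltW.
apply: ler_sum => k _.
rewrite normrM mulrC -mulrA; apply: ler_pM => //; first exact: eigenfun1M_norm.
rewrite ger0_norm ?exprn_ge0 ?(ltW q0) // -exprD exprn_anti //.
by apply: (@leq_trans (n + k).+1) => //; rewrite -{1}(expn1 (n + k).+1) leq_pexp2l.
Qed.

Lemma cvg_dirichlet_sum q x y : 0 < q < 1 ->
  dirichlet_sum q n x y @[n --> \oo] --> dirichlet_kernel q x y.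
Proof.
move=> q01; have /andP[q0 q1] := q01.
have -> : (fun n => dirichlet_sum q n x y) =
  series (fun k => q ^+ (k.+1 ^ 2) * (eigenfun1 k.+1 x * eigenfun1 k.+1 y)).
  by apply/funext => n; rewrite /dirichlet_sum /series /= big_mkord.
have -> : dirichlet_kernel q x y = limn 
  (series (fun k => q ^+ (k.+1 ^ 2) * (eigenfun1 k.+1 x * eigenfun1 k.+1 y))).
  congr (limn _).
  by apply/funext => n; rewrite /dirichlet_sum /series /= big_mkord.
apply: normed_cvg.
apply: (@series_le_cvg _ _ (geometric 2 q)) => [k|k|k|].
- exact: normr_ge0.
- by rewrite /= mulr_ge0 // exprn_ge0 // ltW.
- rewrite /= normrM mulrC; apply: ler_pM => //; first exact: eigenfun1M_norm.
  rewrite ger0_norm ?exprn_ge0 ?(ltW q0) // exprn_anti //.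
  by apply: (@leq_trans k.+1) => //; rewrite -{1}(expn1 k.+1) leq_pexp2l.
- by apply: is_cvg_geometric_series; rewrite ger0_norm // ltW.
Qed.

Lemma dirichlet_kernel_dist q n x y : 0 < q < 1 ->
  `|dirichlet_kernel q x y - dirichlet_sum q n x y| <= 2 * (1 - q)^-1 * q ^+ n.
Proof.
move=> q01; have H := @cvg_dirichlet_sum q x y q01.
have H' : `|dirichlet_sum q m x y - dirichlet_sum q n x y| @[m --> \oo] -->
   `|dirichlet_kernel q x y - dirichlet_sum q n x y|.
  by apply: cvg_norm; apply: cvgB => //; exact: cvg_cst.
rewrite -(cvg_lim _ H') //; apply: limr_le.
  by apply/cvg_ex; eexists; exact: H'.
by exists n => // m /= nm; exact: dirichlet_sum_dist.
Qed.

Lemma dirichlet_kernel_norm q x y : 0 < q < 1 ->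
  `|dirichlet_kernel q x y| <= 2 * (1 - q)^-1.
Proof.
move=> q01; have := @dirichlet_kernel_dist q 0 x y q01.
by rewrite /dirichlet_sum big_ord0 subr0 expr0 mulr1.
Qed.

Lemma dirichlet_kernelC q x y : dirichlet_kernel q x y = dirichlet_kernel q y x.
Proof.
congr (limn _); apply/funext => n; apply: eq_bigr => k _.
by rewrite (mulrC (eigenfun1 _ _)).
Qed.

Lemma sin_lipschitz (x y : R) : `|sin x - sin y| <= `|x - y|.
Proof.
wlog xy : x y / y <= x.
  move=> H; case: (leP y x) => [/H //|/ltW/H].
  by rewrite distrC [leRHS]distrC.
have [c _ ->] := @MVT_segment R sin cos y x xy (fun z _ => is_derive_sin z)
  (continuous_subspaceT (@continuous_sin R)).
by rewrite normrM ler_piMl // ler_norml cos_geN1 cos_le1.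
Qed.

(** The k-th term of the series has slope at most 2 pi k q^(k^2), and the slopes are
    summable. *)
Lemma dirichlet_kernel_lipschitz q x x' y : 0 < q < 1 ->
  `|dirichlet_kernel q x y - dirichlet_kernel q x' y| <=
  2 * pi * (1 - q)^-1 ^+ 2 * `|x - x'|.
Proof.
move=> q01; have /andP[q0 q1] := q01.
have H' : `|dirichlet_sum q m x y - dirichlet_sum q m x' y| @[m --> \oo] -->
   `|dirichlet_kernel q x y - dirichlet_kernel q x' y|.
  by apply: cvg_norm; apply: cvgB; exact: cvg_dirichlet_sum.
rewrite -(cvg_lim _ H') //; apply: limr_le.
  by apply/cvg_ex; eexists; exact: H'.
apply: nearW => n.
rewrite /dirichlet_sum -sumrB; apply: le_trans (ler_norm_sum _ _ _) _.
have i0 : 0 <= (1 - q)^-1 by rewrite invr_ge0; lra.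
have := geometric_sum_le n q01 => gs.
apply: (@le_trans _ _
  (\sum_(k < n) 2 * pi * (1 - q)^-1 * `|x - x'| * q ^+ k)); last first.
  rewrite -mulr_sumr; have -> : 2 * pi * (1 - q)^-1 ^+ 2 * `|x - x'| =
    2 * pi * (1 - q)^-1 * `|x - x'| * (1 - q)^-1 by ring.
  by rewrite ler_wpM2l // !mulr_ge0 // pi_ge0.
apply: ler_sum => k _.
have -> : q ^+ (k.+1 ^ 2) * (eigenfun1 k.+1 x * eigenfun1 k.+1 y) -
   q ^+ (k.+1 ^ 2) * (eigenfun1 k.+1 x' * eigenfun1 k.+1 y) =
   q ^+ (k.+1 ^ 2) * (Num.sqrt 2 ^+ 2 *
     (sin (k.+1%:R * pi * x) - sin (k.+1%:R * pi * x')) * sin (k.+1%:R * pi * y)).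
  by rewrite /eigenfun1; move: (q ^+ _) => p; ring.
rewrite sqr_sqrtr // !normrM (ger0_norm (exprn_ge0 _ (ltW q0))) (@ger0_norm _ 2) //.
have s1 : `|sin (k.+1%:R * pi * x) - sin (k.+1%:R * pi * x')| <=
    k.+1%:R * pi * `|x - x'|.
  apply: (le_trans (sin_lipschitz _ _)).
  by rewrite -mulrBr normrM ger0_norm // mulr_ge0 // pi_ge0.
have s2 : `|sin (k.+1%:R * pi * y)| <= 1 by rewrite ler_norml sin_geN1 sin_le1.
apply: (@le_trans _ _ (q ^+ (k.+1 ^ 2) * (2 * (k.+1%:R * pi * `|x - x'|)))).
  rewrite ler_wpM2l ?exprn_ge0 ?(ltW q0) //.
  apply: (@le_trans _ _ (2 * (k.+1%:R * pi * `|x - x'|) * 1)); last by rewrite mulr1.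
  by apply: ler_pM => //; rewrite ler_wpM2l.
(* One factor q^(k+1) pays for the slope k + 1; the remaining q^((k+1)k) <= q^k
   is summed as a geometric series. *)
have -> : (k.+1 ^ 2 = k.+1 + k.+1 * k)%N by rewrite -mulnn mulnS.
rewrite exprD.
have -> : q ^+ k.+1 * q ^+ (k.+1 * k) * (2 * (k.+1%:R * pi * `|x - x'|)) =
   (2 * pi * `|x - x'|) * ((k.+1%:R * q ^+ k.+1) * q ^+ (k.+1 * k)).
  by move: (q ^+ _) (q ^+ _) k.+1%:R => p1 p2 p3; ring.
have -> : 2 * pi * (1 - q)^-1 * `|x - x'| * q ^+ k =
  (2 * pi * `|x - x'|) * ((1 - q)^-1 * q ^+ k).
  by move: (q ^+ _) => p1; ring.
rewrite ler_wpM2l ?mulr_ge0 ?pi_ge0 //; apply: ler_pM.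
- by rewrite mulr_ge0 // exprn_ge0 // ltW.
- by rewrite exprn_ge0 // ltW.
- exact: natrX_bound.
- by rewrite exprn_anti // leq_pmull.
Qed.

Lemma continuous_dirichlet_kernel q x : 0 < q < 1 ->
  continuous (dirichlet_kernel q x).
Proof.
move=> q01 y; have /andP[q0 q1] := q01.
set L := 2 * pi * (1 - q)^-1 ^+ 2.
have L0 : 0 < L by rewrite !mulr_gt0 ?pi_gt0 ?exprn_gt0 ?invr_gt0 //; lra.
apply/cvgrPdist_le => e e0; near=> z.
rewrite ![dirichlet_kernel _ x _]dirichlet_kernelC.
apply: le_trans (dirichlet_kernel_lipschitz _ _ _ q01) _.
rewrite -/L mulrC -ler_pdivlMr //.
near: z; apply: (@cvgr_dist_le _ _ _ (nbhs y) _ id); [exact: cvg_id|exact: divr_gt0].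
Unshelve. all: by end_near.
Qed.

Lemma geometric_bound_le0 q (c r : R) : 0 < q < 1 ->
  (forall n, r <= c * q ^+ n) -> r <= 0.
Proof.
move=> q01 H; have /andP[q0 q1] := q01.
have C : (fun n => c * q ^+ n) @ \oo --> (0 : R).
  by apply: cvg_geometric; rewrite ger0_norm // ltW.
rewrite -(cvg_lim _ C) //; apply: limr_ge; last exact: nearW.
by apply/cvg_ex; eexists; exact: C.
Qed.

(** The maximum principle for the heat equation on (0, 1), read off the finite theta
    polynomials up to an error that tends to 0. *)
Lemma dirichlet_kernel_ge0 q x y : 0 < q < 1 -> 0 <= x <= 1 -> 0 <= y <= 1 ->
  0 <= dirichlet_kernel q x y.
Proof.
move=> q01 x01 y01; rewrite -oppr_le0.
apply: (@geometric_bound_le0 q (2 * (1 - q)^-1 + 2 * (1 - q)^-1 ^+ 2)) => // n.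
have := dirichlet_kernel_dist n x y q01; rewrite ler_norml => /andP[+ _].
have := dirichlet_sum_ge n q01 x01 y01; lra.
Qed.

Lemma continuous_cos_poly n (a : R) (b : nat -> R) :
  continuous (fun y : R => a + \sum_(k < n) b k * cos (k.+1%:R * pi * y)).
Proof.
elim: n => [|n IH] y.
  under eq_fun do rewrite big_ord0 addr0.
  exact: cvg_cst.
under eq_fun do rewrite big_ord_recr addrA.
apply: cvgD; first exact: IH.
apply: cvgM; first exact: cvg_cst.
apply: continuous_comp; last exact: continuous_cos.
by apply: cvgM; [exact: cvg_cst|exact: cvg_id].
Qed.

Lemma integral_cos_poly n (a : R) (b : nat -> R) :
  (\int[lebesgue_measure]_(y in `[(0%R : R), 1%R])
     (a + \sum_(k < n) b k * cos (k.+1%:R * pi * y))%:E = a%:E)%E.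
Proof.
(* G k is a primitive of the k-th cosine, F one of the whole sum. *)
pose G k := fun y : R => b k / (k.+1%:R * pi) * sin (k.+1%:R * pi * y).
pose F : R -> R := (a \*: (id : R -> R)) + \sum_(k < n) G k.
pose f := fun y : R => a + \sum_(k < n) b k * cos (k.+1%:R * pi * y).
have c0 k : (k.+1%:R * pi : R) != 0 by rewrite mulf_neq0 // gt_eqF // pi_gt0.
have dG k (y : R) : is_derive y 1 (G k) (b k * cos (k.+1%:R * pi * y)).
  have H : is_derive y 1 (( *:%R (k.+1%:R * pi)) : R -> R) (k.+1%:R * pi).
    apply: is_derive_eq (is_deriveZ _ (is_derive_id y 1)) _.
    by rewrite /GRing.scale /= mulr1.
  have := is_derive1_comp (is_derive_sin (k.+1%:R * pi * y)) H.
  move=> /(is_deriveZ (b k / (k.+1%:R * pi))) => K.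
  apply: (is_derive_eq K); rewrite /GRing.scale /=.
  by rewrite [cos _ * _]mulrC mulrA divfK.
have dF (y : R) : is_derive y 1 F (f y).
  have K := is_deriveD (is_deriveZ a (is_derive_id y 1))
    (is_derive_sum (fun k : 'I_n => dG k y)).
  by apply: (is_derive_eq K); rewrite /GRing.scale /= mulr1.
have cF : continuous F.
  by move=> y; apply/differentiable_continuous/derivable1_diffP; have [] := dF y.
have cf : continuous f by exact: continuous_cos_poly.
rewrite (@continuous_FTC2 _ f F) //.
- have F0 : F 0 = 0.
    rewrite /F /= fctE fct_sumE /= scaler0 add0r big1 // => k _.
    by rewrite /G mulr0 sin0 mulr0.
  have F1 : F 1 = a.
    rewrite /F /= fctE fct_sumE /= /GRing.scale /= mulr1 big1 ?addr0 // => k _.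
    rewrite /G mulr1 mulr_natl -[pi *+ _]add0r (alternatingn (@sinDpi R)).
    by rewrite sin0 !mulr0.
  by rewrite F0 F1 -EFinB subr0.
- exact: continuous_subspaceT.
- split; first by move=> y _; have [] := dF y.
    exact/cvg_at_right_filter/cF.
  exact/cvg_at_left_filter/cF.
- by move=> y _; rewrite derive1E derive_val.
Qed.

(** The Dirichlet kernel is dominated by the Neumann kernel, which has mass 1: heat is
    only lost through the boundary.  The comparison is made with the finite
    cosine sums of [dirichlet_sum_le], which are integrated exactly. *)
Lemma integral_dirichlet_kernel_le1 q x : 0 < q < 1 -> 0 <= x <= 1 ->
  (\int[lebesgue_measure]_(y in `](0%R : R), 1%R[)
     (dirichlet_kernel q x y)%:E <= 1)%E.
Proof.
move=> q01 x01.
have mG D : measurable_fun D (fun y => (dirichlet_kernel q x y)%:E).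
  apply/measurable_EFinP; apply: measurable_funTS.
  by apply: continuous_measurable_fun; exact: continuous_dirichlet_kernel.
have G0 y : 0 <= y <= 1 -> (0 <= (dirichlet_kernel q x y)%:E)%E.
  by rewrite lee_fin => y01; exact: dirichlet_kernel_ge0.
set I := (\int[lebesgue_measure]_(_ in _) _)%E.
(* The closed interval is the one to which the fundamental theorem applies. *)
have IJ : (I <= \int[lebesgue_measure]_(y in `[(0%R : R), 1%R])
                  (dirichlet_kernel q x y)%:E)%E.
  apply: ge0_subset_integral => //.
    exact: mG.
  by move=> y; rewrite /= !in_itv /= => /andP[/ltW -> /ltW ->].
have J n : (I <= (1 + (2 * (1 - q)^-1 + 2 * (1 - q)^-1 ^+ 2) * q ^+ n)%:E)%E.
  set c := _ * q ^+ n; apply: (le_trans IJ).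
  rewrite -(integral_cos_poly n (1 + c)
    (fun k => 2 * theta_coef q n k.+1 * cos (k.+1%:R * pi * x))).
  apply: ge0_le_integral => //.
  - exact: mG.
  - apply/measurable_EFinP; apply: measurable_funTS; apply: continuous_measurable_fun.
    exact: (@continuous_cos_poly n (1 + c)
      (fun k => 2 * theta_coef q n k.+1 * cos (k.+1%:R * pi * x))).
  move=> y _; rewrite lee_fin.
  have := dirichlet_kernel_dist n x y q01; rewrite ler_norml => /andP[_ +].
  have := dirichlet_sum_le n x y q01.
  rewrite /c mulrDl; lra.
have I0 : (0 <= I)%E.
  apply: integral_ge0 => y; rewrite /= in_itv /= => /andP[/ltW y0 /ltW y1].
  by rewrite G0 // y0.
have fI : I \is a fin_num.
  by rewrite ge0_fin_numE //; exact: le_lt_trans (J 0%N) (ltry _).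
rewrite -(fineK fI) lee_fin -subr_le0.
apply: (@geometric_bound_le0 q (2 * (1 - q)^-1 + 2 * (1 - q)^-1 ^+ 2) _ q01) => n.
by have := J n; rewrite -[X in (X <= _)%E -> _](fineK fI) lee_fin lerBlDl.
Qed.
End dirichlet_kernel.

(** * Products over the coordinates *)

Section tensor_products.
Context {R : realType}.
Notation RT := (measurableTypeR R).

(** The parameter q for which the weights exp (- k^2 pi^2 t) are the q^(k^2) of theta
    series. *)
Definition heat_nome (t : R) : R := expR (- (pi ^+ 2 * t)).

Lemma heat_nome01 (t : R) : 0 < t -> 0 < heat_nome t < 1.
Proof.
by move=> t0; rewrite expR_gt0 expR_lt1 oppr_lt0 mulr_gt0 // exprn_gt0 // pi_gt0.
Qed.

(** The weight exp (- |k|^2 pi^2 t) factors over the coordinates, so by distributivity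
    the partial sum over a box of multi-indices is a product of one-dimensional
    partial sums. *)
Lemma heat_kernelE d (t : R) (x y : 'rV[R]_d) : 0 < t ->
  heat_kernel t x y =
  \prod_(j < d) dirichlet_kernel (heat_nome t) (x ord0 j) (y ord0 j).
Proof.
move=> t0; have q01 := heat_nome01 t0.
have S N : \sum_(k : {ffun 'I_d -> 'I_N})
    (let k1 j := (k j).+1 in
    expR (- (\sum_(j < d) (k1 j)%:R ^+ 2) * pi ^+ 2 * t) *
      eigenfun k1 x * eigenfun k1 y) =
  \prod_(j < d) dirichlet_sum (heat_nome t) N (x ord0 j) (y ord0 j).
  rewrite /dirichlet_sum bigA_distr_bigA /=; apply: eq_bigr => k _.
  rewrite big_split big_split /= mulrA; congr (_ * _ * _).
  rewrite !mulNr -!mulrA mulr_suml -sumrN expR_sum; apply: eq_bigr => j _.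
  by rewrite /heat_nome -expRM_natl natrX; congr expR; ring.
rewrite /heat_kernel; under eq_fun do rewrite S.
apply: cvg_lim => //.
apply: cvg_big => [|j _]; first exact: mul_continuous.
exact: cvg_dirichlet_sum.
Qed.

Lemma ler_prod_dist d (C : R) (a b : 'I_d -> R) : 1 <= C ->
  (forall j, `|a j| <= C) -> (forall j, `|b j| <= C) ->
  `|\prod_j a j - \prod_j b j| <= C ^+ d * \sum_j `|a j - b j|.
Proof.
move=> C1; have C0 : 0 <= C by exact: le_trans C1.
elim: d a b => [|d IH] a b Ha Hb.
  by rewrite !big_ord0 subrr normr0 mulr0.
rewrite !big_ord_recl.
have -> : a ord0 * \prod_(i < d) a (lift ord0 i) -
    b ord0 * \prod_(i < d) b (lift ord0 i) =
  (a ord0 - b ord0) * \prod_(i < d) a (lift ord0 i) +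
  b ord0 * (\prod_(i < d) a (lift ord0 i) - \prod_(i < d) b (lift ord0 i)) by ring.
rewrite (le_trans (ler_normD _ _)) // [leRHS]mulrDr lerD // normrM.
  rewrite mulrC; apply: ler_pM => //.
  rewrite normr_prod; apply: (@le_trans _ _ (\prod_(i < d) C)).
    by apply: ler_prod => i _; rewrite normr_ge0 Ha.
  by rewrite prodr_const card_ord exprS ler_peMl // exprn_ge0.
rewrite exprS -mulrA; apply: ler_pM => //.
by apply: IH => j.
Qed.

(** Tonelli along the recursive construction of Lebesgue measure on tuples. *)
Lemma integral_prod_tuple_le1 d (h : 'I_d -> R -> R) :
  (forall j, measurable_fun setT (h j : RT -> R)) -> (forall j y, 0 <= h j y) ->
  (forall j, (\int[@lebesgue_measure R]_y (h j y)%:E <= 1)%E) ->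
  (\int[lebesgue_tuple d]_y (\prod_(j < d) h j (tnth y j))%:E <= 1)%E.
Proof.
move=> mh h0 h1.
have mprod n (k : 'I_n -> R -> R) :
    (forall j, measurable_fun setT (k j : RT -> R)) ->
    measurable_fun setT (fun y : n.-tuple RT => \prod_(j < n) k j (tnth y j)).
  move=> mk.
  apply: measurable_prod => j _.
  exact: measurableT_comp (mk j) (measurable_tnth j).
elim: d h mh h0 h1 => [|d IH] h mh h0 h1.
  under eq_integral do rewrite big_ord0.
  by rewrite integral_dirac //= mule1 diracT.
rewrite /=.
pose H (y : d.+1.-tuple RT) := (\prod_(j < d.+1) h j (tnth y j))%:E.
have mH : measurable_fun setT H by apply/measurable_EFinP; exact: mprod.
have H0 y : (0 <= H y)%E by rewrite lee_fin prodr_ge0.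
have -> : (\int[lebesgue_tuple_step (lebesgue_tuple d)]_y H y =
  \int[(@lebesgue_measure R \x lebesgue_tuple d)%E]_p H (cons_pair p))%E.
  apply: (@ge0_integral_pushforward _ _ _ _ _ _ (@measurable_cons_pair R d)) => //.
rewrite fubini_tonelli1 //; last first.
  by apply: measurableT_comp => //; exact: measurable_cons_pair.
apply: le_trans (h1 ord0).
have mHc : measurable_fun setT (H \o @cons_pair R d).
  by apply: measurableT_comp => //; exact: measurable_cons_pair.
apply: ge0_le_integral => //.
- by move=> x _; apply: integral_ge0 => y _; exact: H0.
- by apply: measurable_fun_fubini_tonelli_F => // p; exact: H0.
- exact/measurable_EFinP.
move=> x _; rewrite /fubini_F.
have HE (t : d.-tuple RT) : H (cons_pair (x, t)) =
    ((h ord0 x)%:E * (\prod_(j < d) h (lift ord0 j) (tnth t j))%:E)%E.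
  rewrite /H big_ord_recl -EFinM /cons_pair /= tnth0; congr (_ * _)%:E.
  by apply: eq_bigr => j _; rewrite tnthS.
under eq_integral do rewrite HE.
rewrite ge0_integralZl //.
- rewrite -[leRHS]mule1; apply: lee_wpmul2l; first by rewrite lee_fin.
  by apply: (IH (fun j => h (lift ord0 j))).
- by apply/measurable_EFinP; exact: (mprod _ (fun j => h (lift ord0 j))).
- by move=> t _; rewrite lee_fin prodr_ge0.
- by rewrite lee_fin.
Qed.

Lemma measurable_tuple_box d (A : 'I_d -> set RT) : (forall j, measurable (A j)) ->
  measurable [set t : d.-tuple RT | forall j, A j (tnth t j)].
Proof.
move=> mA.
have -> : [set t : d.-tuple RT | forall j, A j (tnth t j)] =
    \bigcap_(j in [set: 'I_d]) ((fun t : d.-tuple RT => tnth t j) @^-1` A j).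
  by apply/seteqP; split => t /= H j; [move=> _|]; exact: H.
apply: fin_bigcap_measurable => // j _.
by rewrite -[X in measurable X]setTI; apply: measurable_tnth.
Qed.

(** The product sigma-algebra on tuples contains the open sets of the row-vector
    topology because an open set is a countable union of rational boxes. *)
Lemma open_preimage_row_of_tuple_measurable d (W : set 'rV[R]_d) : open W ->
  measurable (@row_of_tuple R d @^-1` W).
Proof.
move=> oW.
pose box (p : {ffun 'I_d -> rat} * nat) : set (d.-tuple RT) :=
  [set t | forall j, ball (ratr (p.1 j) : R) p.2.+1%:R^-1 (tnth t j)].
have -> : @row_of_tuple R d @^-1` W =
    \bigcup_(p in [set p | box p `<=` @row_of_tuple R d @^-1` W]) box p.
  apply/seteqP; split => [t /= Wt|t [p /= pW pt]]; last exact: pW.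
  have /nbhs_ballP[e /= e0 eW] : nbhs (row_of_tuple t) W by apply: open_nbhs_nbhs.
  have [n ne] : exists n : nat, n.+1%:R^-1 < e / 2.
    have e20 : 0 < e / 2 by rewrite divr_gt0.
    exists (Num.truncn (e / 2)^-1).
    by rewrite invf_plt ?posrE // truncnS_gt.
  have n0 : 0 < n.+1%:R^-1 :> R by rewrite invr_gt0.
  have /choice[f Hf] (j : 'I_d) :
      exists r : rat, ball (tnth t j) n.+1%:R^-1 (ratr r : R).
    have : (tnth t j : R) - n.+1%:R^-1 < (tnth t j : R) + n.+1%:R^-1.
      by rewrite ltrD2l gtrN.
    move=> /rat_in_itvoo[r]; rewrite in_itv /= => rt; exists r.
    by rewrite ball_itv /= in_itv.
  exists ([ffun j => f j], n) => /=; last first.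
    by move=> j; rewrite /= ffunE; apply: ball_sym; exact: Hf.
  move=> s /= Hs; apply: eW; split => // i j; rewrite !mxE.
  have := Hs j; rewrite ffunE => /(ball_triangle (Hf j)).
  by apply: le_ball; rewrite [leRHS]splitr lerD // ltW.
rewrite bigcup_mkcond; apply: countable_bigcupT_measurable => // p.
case: ifPn => // _.
apply: (@measurable_tuple_box _ (fun j => ball (ratr (p.1 j) : R) p.2.+1%:R^-1)) => j.
by apply: open_measurable; exact: ball_open.
Qed.

Lemma cubeO_open d : open (cubeO d : set 'rV[R]_d).
Proof.
rewrite openE => x Hx; rewrite /interior.
apply: (@filter_forall _ _ (fun (j : 'I_d) (y : 'rV[R]_d) => 0 < y ord0 j < 1)
  (nbhs x) (nbhs_filter x)) => j.
have : nbhs (x ord0 j) `]0, 1[%classic.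
  by apply: open_nbhs_nbhs; split; [exact: interval_open|rewrite /= in_itv /= Hx].
move=> /(@coord_continuous _ _ _ ord0 j x) /=.
by apply: (@filterS _ (nbhs x) (nbhs_filter x)) => y; rewrite /= in_itv.
Qed.

Lemma cubeOC d (x : 'rV[R]_d) : cubeO d x -> cubeC d x.
Proof. by move=> H j; case/andP: (H j) => /ltW -> /ltW ->. Qed.

Lemma measurable_cube_tuple d : measurable (@cube_tuple R d).
Proof. by apply: open_preimage_row_of_tuple_measurable; exact: cubeO_open. Qed.

Lemma within_cube_measurable d (phi : 'rV[R]_d -> R) :
  {within cubeC d, continuous phi} ->
  measurable_fun (cube_tuple d) (phi \o @row_of_tuple R d).
Proof.
move=> /subspace_continuousP cphi.
move=> mD; apply: (measurability _ (RGenOpens.measurableE R)) mD.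
move=> _ [_ [a [b ->] <-]].
have -> : cube_tuple d `&` (phi \o @row_of_tuple R d) @^-1` `]a, b[ =
  @row_of_tuple R d @^-1` (cubeO d `&` phi @^-1` `]a, b[) by [].
apply: open_preimage_row_of_tuple_measurable.
rewrite openE => x [Ox xab]; rewrite /interior.
have := cphi x (cubeOC Ox) `]a, b[%classic.
have nb : nbhs (phi x) `]a, b[%classic.
  by apply: open_nbhs_nbhs; split; [exact: interval_open|].
move=> /(_ nb); rewrite /= /within /=.
have := open_nbhs_nbhs (conj (@cubeO_open d) Ox).
by apply: filterS2 => y Oy Hy; split => //; apply: Hy; exact: cubeOC.
Qed.
End tensor_products.

(** * The heat semigroup on the cube *)

Section cube_heat_kernel.
Context {R : realType} {d : nat}.
Notation RT := (measurableTypeR R).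
Implicit Types (x : 'rV[R]_d) (t : R).

Lemma integral_prod_cube_le1 (h : 'I_d -> R -> R) :
  (forall j, measurable_fun (`](0 : R), 1[%classic : set RT) (h j : RT -> R)) ->
  (forall j y, 0 < y < 1 -> 0 <= h j y) ->
  (forall j, (\int[@lebesgue_measure R]_(z in `](0%R : R), 1%R[)
                (h j z)%:E <= 1)%E) ->
  (\int[lebesgue_tuple d]_(y in cube_tuple d)
     (\prod_(j < d) h j (tnth y j))%:E <= 1)%E.
Proof.
move=> mh h0 h1.
pose I01 : set R := `](0 : R), 1[%classic.
pose k j := (h j) \_ I01.
have -> : (\int[lebesgue_tuple d]_(y in cube_tuple d)
      (\prod_(j < d) h j (tnth y j))%:E =
    \int[lebesgue_tuple d]_y (\prod_(j < d) k j (tnth y j))%:E)%E.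
  rewrite integral_mkcond; congr integral; apply/funext => t.
  rewrite patchE; case: ifPn => [|]; rewrite (inE, notin_setE) => yc.
    congr EFin; apply: eq_bigr => j _; rewrite /k patchE mem_set //.
    by rewrite /I01 /= in_itv /=; have := yc j; rewrite mxE.
  have [j yj] : exists j, ~ (0 < tnth t j < 1).
    by apply/existsNP => H; apply: yc => j; rewrite mxE.
  by rewrite (bigD1 j) //= /k patchE memNset ?mul0r // /I01 /= in_itv /=.
apply: integral_prod_tuple_le1.
- move=> j.
  have mI : measurable (I01 : set RT) by exact: measurable_itv.
  exact: (measurable_restrictT (h j : RT -> R) mI).1 (mh j).
- move=> j y; rewrite /k patchE; case: ifPn => //.
  by rewrite inE /I01 /= in_itv /=; exact: h0.
- move=> j; have := h1 j; rewrite integral_mkcond.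
  by rewrite -/(EFin \o h j) restrict_EFin.
Qed.

Lemma cube_tuple_measure_le1 : (lebesgue_tuple d (@cube_tuple R d) <= 1)%E.
Proof.
have : (\int[lebesgue_tuple d]_(y in @cube_tuple R d)
          (\prod_(j < d) (1 : R))%:E <= 1)%E.
  apply: (@integral_prod_cube_le1 (fun _ _ => 1)) => // j.
  by rewrite integral_cst //= mul1e lebesgue_measure_itv /= lte_fin ltr01 oppr0 adde0.
under eq_integral do rewrite big1 //.
by rewrite integral_cst ?mul1e //; exact: measurable_cube_tuple.
Qed.

Lemma heat_kernel_ge0 t x (y : 'rV[R]_d) : 0 < t -> cubeC d x -> cubeC d y ->
  0 <= heat_kernel t x y.
Proof.
move=> t0 Cx Cy; rewrite heat_kernelE //; apply: prodr_ge0 => j _.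
exact: (dirichlet_kernel_ge0 (heat_nome01 t0)).
Qed.

Lemma measurable_heat_kernel t x D : 0 < t ->
  measurable_fun D (fun y : d.-tuple RT => heat_kernel t x (row_of_tuple y)).
Proof.
move=> t0; under eq_fun do rewrite heat_kernelE //.
apply: measurable_funTS; apply: measurable_prod => j _.
under eq_fun do rewrite mxE.
apply: measurableT_comp (measurable_tnth j).
apply: continuous_measurable_fun; exact: (continuous_dirichlet_kernel (heat_nome01 t0)).
Qed.

Lemma integral_heat_kernel_le1 t x : 0 < t -> cubeC d x ->
  (\int[lebesgue_tuple d]_(y in cube_tuple d)
     (heat_kernel t x (row_of_tuple y))%:E <= 1)%E.
Proof.
move=> t0 Cx; have q01 := heat_nome01 t0.
under eq_integral do (rewrite heat_kernelE //; under eq_bigr do rewrite mxE).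
apply: (@integral_prod_cube_le1 (fun j => dirichlet_kernel (heat_nome t) (x ord0 j))).
- move=> j; apply: measurable_funTS; apply: continuous_measurable_fun.
  exact: continuous_dirichlet_kernel.
- move=> j y /andP[/ltW y0 /ltW y1].
  by apply: dirichlet_kernel_ge0 => //; rewrite y0.
- by move=> j; exact: integral_dirichlet_kernel_le1.
Qed.

Lemma integrable_heat_kernel t x : 0 < t -> cubeC d x ->
  (lebesgue_tuple d).-integrable (cube_tuple d)
    (fun y => (heat_kernel t x (row_of_tuple y))%:E).
Proof.
move=> t0 Cx; apply/integrableP; split.
  by apply/measurable_EFinP; exact: measurable_heat_kernel.
apply: le_lt_trans (ltry 1).
under eq_integral => y.
  rewrite inE => Cy; rewrite gee0_abs; last first.
    by rewrite lee_fin heat_kernel_ge0 //; exact: cubeOC.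
  over.
exact: integral_heat_kernel_le1.
Qed.

Lemma heat_kernel_lipschitz t : 0 < t -> exists2 K, 0 < K & forall x x' (y : 'rV[R]_d),
  `|heat_kernel t x y - heat_kernel t x' y| <= K * \sum_j `|x ord0 j - x' ord0 j|.
Proof.
move=> t0; have q01 := heat_nome01 t0; have /andP[q0 q1] := q01.
set q := heat_nome t in q01 q0 q1.
have i0 : 0 < (1 - q)^-1 by rewrite invr_gt0; lra.
pose C := 1 + 2 * (1 - q)^-1.
have C1 : 1 <= C by rewrite /C; lra.
have C0 : 0 < C by exact: lt_le_trans C1.
exists (C ^+ d * (2 * pi * (1 - q)^-1 ^+ 2)).
  by rewrite !mulr_gt0 ?exprn_gt0 ?pi_gt0.
move=> x x' y; rewrite !heat_kernelE //.
have bC (z : 'rV[R]_d) j : `|dirichlet_kernel q (z ord0 j) (y ord0 j)| <= C.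
  by apply: le_trans (dirichlet_kernel_norm _ _ q01) _; rewrite /C lerDr.
apply: (le_trans (ler_prod_dist C1 (bC x) (bC x'))).
rewrite -[leRHS]mulrA ler_wpM2l ?exprn_ge0 ?(ltW C0) // mulr_sumr.
by apply: ler_sum => j _; exact: dirichlet_kernel_lipschitz.
Qed.

Section smoothing.
Variables (t : R) (phi : d.-tuple RT -> R).
Hypothesis t0 : 0 < t.
Hypothesis mphi : measurable_fun (cube_tuple d) phi.
Hypothesis phi1 : forall y, cube_tuple d y -> `|phi y| <= 1.

Let U x : R :=
  \int[lebesgue_tuple d]_(y in cube_tuple d)
    (heat_kernel t x (row_of_tuple y) * phi y).

Lemma integrable_smoothing x : cubeC d x ->
  (lebesgue_tuple d).-integrable (cube_tuple d)
    (fun y => (heat_kernel t x (row_of_tuple y) * phi y)%:E).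
Proof.
move=> Cx; apply: le_integrable (integrable_heat_kernel t0 Cx).
- exact: measurable_cube_tuple.
- apply/measurable_EFinP; apply: measurable_funM => //.
  exact: measurable_heat_kernel.
- move=> y Cy; rewrite !abse_EFin lee_fin normrM ler_piMr //; exact: phi1.
Qed.

Lemma smoothing_norm_le1 x : cubeC d x -> `|U x| <= 1.
Proof.
move=> Cx; have mC := @measurable_cube_tuple R d.
have iU := integrable_smoothing Cx.
apply: (le_trans (le_normr_Rintegral mC iU)).
apply: (@le_trans _ _ (\int[lebesgue_tuple d]_(y in cube_tuple d)
    heat_kernel t x (row_of_tuple y))).
  apply: le_Rintegral => //.
  - exact: integrable_norm iU.
  - exact: integrable_heat_kernel.
  - move=> y Cy.
    have h0 : 0 <= heat_kernel t x (row_of_tuple y).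
      by apply: heat_kernel_ge0 => //; exact: cubeOC.
    by rewrite normrM ger0_norm // ler_piMr //; exact: phi1.
rewrite -lee_fin; apply: le_trans (integral_heat_kernel_le1 t0 Cx).
rewrite /Rintegral fineK //.
exact: (integrable_fin_num mC (integrable_heat_kernel t0 Cx)).
Qed.

(** The Lipschitz constant of the kernel in x is uniform in y and the cube has finite
    measure, so U inherits it. *)
Lemma smoothing_continuous : {within cubeC d, continuous U}.
Proof.
have mC := @measurable_cube_tuple R d.
have [K K0 HK] := heat_kernel_lipschitz t0.
have LU x x' : cubeC d x -> cubeC d x' ->
    `|U x - U x'| <= K * \sum_j `|x ord0 j - x' ord0 j|.
  move=> Cx Cx'; set c := K * _.
  have c0 : 0 <= c by rewrite mulr_ge0 ?(ltW K0) ?sumr_ge0.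
  have iB : (lebesgue_tuple d).-integrable (cube_tuple d)
     (fun y => (heat_kernel t x (row_of_tuple y) * phi y
               - heat_kernel t x' (row_of_tuple y) * phi y)%:E).
    exact: (integrableB mC (integrable_smoothing Cx) (integrable_smoothing Cx')).
  have finC : (lebesgue_tuple d (@cube_tuple R d) < +oo)%E.
    by apply: le_lt_trans cube_tuple_measure_le1 (ltry 1).
  have -> : U x - U x' = \int[lebesgue_tuple d]_(y in cube_tuple d)
     (heat_kernel t x (row_of_tuple y) * phi y
      - heat_kernel t x' (row_of_tuple y) * phi y).
    by rewrite RintegralB //; exact: integrable_smoothing.
  apply: (le_trans (le_normr_Rintegral mC iB)).
  apply: (@le_trans _ _ (\int[lebesgue_tuple d]_(y in cube_tuple d) c)).
    apply: le_Rintegral => //.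
    - exact: integrable_norm iB.
    - apply/integrableP; split; first exact: measurable_cst.
      rewrite /= ger0_norm //.
      by rewrite integral_cst // lte_mul_pinfty.
    - move=> y Cy; rewrite -mulrBl normrM.
      by rewrite -[leRHS]mulr1 ler_pM // phi1.
  rewrite Rintegral_cst // ler_piMr //.
  rewrite -lee_fin fineK ?cube_tuple_measure_le1 // ge0_fin_numE //.
apply/subspace_continuousP => x Cx; apply/cvgrPdist_lt => e e0.
(* d + 1 in the radius keeps the denominator nonzero in every dimension. *)
have [n [n0 Hn]] : exists n : R, 0 < n /\ K * (d%:R * n) < e.
  exists (e / (K * d.+1%:R)); split; first by rewrite divr_gt0 // mulr_gt0.
  have -> : K * (d%:R * (e / (K * d.+1%:R))) = e * (d%:R / d.+1%:R).
    have : d.+1%:R != 0 :> R by rewrite pnatr_eq0.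
    have : K != 0 by rewrite gt_eqF.
    by move: d.+1%:R => D K0' D0; field; rewrite K0' D0.
  by rewrite gtr_pMr // ltr_pdivrMr // mul1r ltr_nat.
have : nbhs x (ball x n) by exact: nbhsx_ballx.
rewrite !near_simpl /within /=; apply: (@filterS _ (nbhs x) (nbhs_filter x)) => z xz Cz.
apply: le_lt_trans (LU _ _ Cx Cz) _.
apply: le_lt_trans _ Hn; rewrite ler_wpM2l ?(ltW K0) //.
rewrite mulr_natl -[d in _ *+ d]card_ord -sumr_const; apply: ler_sum => j _.
by apply: ltW; case: xz => _ /(_ ord0 j).
Qed.

End smoothing.
End cube_heat_kernel.

(** * The splitting scheme *)

Lemma cvg_within_in (T : Type) (U : topologicalType) (F : set_system T)
  (FF : Filter F) (g : T -> U) (D : set U) (b : U) :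
  g @ F --> b -> (\forall z \near F, D (g z)) -> g @ F --> within D (nbhs b).
Proof.
move=> gb FD A /= WA; have := gb _ WA.
by apply: filterS2 FD => z Dz; apply.
Qed.

Lemma cvg_pair_nbhs (T : Type) (U V : topologicalType) (F : set_system T)
    (FF : Filter F) (f : T -> U) (g : T -> V) (x : U) (y : V) :
  f @ F --> x -> g @ F --> y -> (f z, g z) @[z --> F] --> (x, y).
Proof. by move=> fx gy; exact: (cvg_pair fx gy). Qed.

Section splitting_step.
Context {R : realType} {d : nat} {Omega : Type}.
Variables (a f : R -> 'rV[R]_d -> R -> R) (Phi : R -> R -> R -> R).
Variables (tau : R) (beta : R -> Omega -> R) (m : nat) (w : Omega).
Variable u : 'rV[R]_d -> R.
Hypothesis tau0 : 0 < tau.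
Hypothesis Ha : {within coef_dom, continuous (uncurry3 a)}.
Hypothesis Hf : {within coef_dom, continuous (uncurry3 f)}.
Hypothesis HPhi : integrator Phi.
Hypothesis cu : {within cubeC d, continuous u}.
Hypothesis u11 : forall x, cubeC d x -> -1 <= u x <= 1.

(** As long as u stays in the domain, the scheme only sees the factors a and f
    themselves, which are jointly continuous, and not their extensions. *)
Lemma star_in (c : R -> 'rV[R]_d -> R -> R) s x : cubeC d x ->
  star c s x (u x) = c s x (u x).
Proof. by move=> Cx; rewrite /star ler_norml u11. Qed.

Lemma Zarg_in x : cubeC d x ->
  (@integrator_dom R) (Zarg a f tau beta m w x (u x)).
Proof.
move=> Cx; split; last by rewrite /= in_itv /= u11.
by split => //=; rewrite in_itv /= andbT mulr_ge0 ?sqr_ge0 ?ltW.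
Qed.

Lemma cvg_star (c : R -> 'rV[R]_d -> R -> R) (s : R) x : 0 <= s ->
  {within coef_dom, continuous (uncurry3 c)} -> cubeC d x ->
  star c s z (u z) @[z --> within (cubeC d) (nbhs x)] --> star c s x (u x).
Proof.
move=> s0 /subspace_continuousP cc Cx.
have H : uncurry3 c (s, z, u z) @[z --> within (cubeC d) (nbhs x)] -->
    uncurry3 c (s, x, u x).
  apply: cvg_comp (cc (s, x, u x) _); last first.
    by split; [split => //=; rewrite in_itv /= s0|rewrite /= in_itv /= u11].
  have FF : Filter (within (cubeC d) (nbhs x)) by exact: within_filter.
  apply: cvg_within_in.
    apply: cvg_pair_nbhs; last by move/subspace_continuousP: cu; apply.
    by apply: cvg_pair_nbhs; [exact: cvg_cst|exact: cvg_within].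
  apply: (@filterS _ _ FF (cubeC d)); last exact: withinT.
  move=> z Cz; split; last by rewrite /= in_itv /= u11.
  by split => //=; rewrite in_itv /= s0.
rewrite star_in //; apply: cvg_trans H; apply: fmap_within_eq => z.
by rewrite inE => Cz; exact: star_in.
Qed.

Lemma integrand_continuous :
  {within cubeC d, continuous
    (fun y => uncurry3 Phi (Zarg a f tau beta m w y (u y)))}.
Proof.
have [/subspace_continuousP cPhi _] := integrator_P0 HPhi.
apply/subspace_continuousP => x Cx.
have s0 : 0 <= time tau m by rewrite mulr_ge0 // ltW.
have ca := cvg_star s0 Ha Cx; have cf := cvg_star s0 Hf Cx.
apply: cvg_comp (cPhi (Zarg a f tau beta m w x (u x)) (Zarg_in Cx)).
have FF : Filter (within (cubeC d) (nbhs x)) by exact: within_filter.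
apply: cvg_within_in.
  apply: cvg_pair_nbhs; last by move/subspace_continuousP: cu; apply.
  apply: cvg_pair_nbhs.
    by apply: cvgM; [apply: cvgM|exact: cvg_cst].
  by apply: cvgD; apply: cvgM => //; exact: cvg_cst.
apply: (@filterS _ _ FF (cubeC d)); last exact: withinT.
exact: Zarg_in.
Qed.

Lemma measurable_integrand : measurable_fun (cube_tuple d)
  (fun y =>
     uncurry3 Phi (Zarg a f tau beta m w (row_of_tuple y) (u (row_of_tuple y)))).
Proof. exact: (within_cube_measurable integrand_continuous). Qed.

Lemma integrand_norm_le1 y : @cube_tuple R d y ->
  `|uncurry3 Phi (Zarg a f tau beta m w (row_of_tuple y) (u (row_of_tuple y)))| <= 1.
Proof.
move=> Cy; have [[/= + _] /=] := Zarg_in (cubeOC Cy).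
rewrite !in_itv /= andbT => s0 v1.
by rewrite ler_norml /uncurry3; exact: integrator_P1.
Qed.

(** The local integrator maps into the domain [-1, 1], and the heat semigroup, being
    positive and sub-Markovian, keeps it there. *)
Lemma splitting_step (v := fun x => \int[lebesgue_tuple d]_(y in cube_tuple d)
    dplt_integrand a f Phi tau beta m w u x (row_of_tuple y)) :
  [/\ (forall x, cubeC d x -> (lebesgue_tuple d).-integrable (cube_tuple d)
        (fun y => (dplt_integrand a f Phi tau beta m w u x (row_of_tuple y))%:E)),
     {within cubeC d, continuous v} &
     forall x, cubeC d x -> -1 <= v x <= 1].
Proof.
split.
- by move=> x Cx; apply: integrable_smoothing => //;
    [exact: measurable_integrand|exact: integrand_norm_le1].
- exact: (smoothing_continuous tau0 measurable_integrand integrand_norm_le1).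
- move=> x Cx; rewrite -ler_norml.
  exact: (smoothing_norm_le1 tau0 measurable_integrand integrand_norm_le1).
Qed.
End splitting_step.

Theorem proposition9 (R : realType) (dsp : measure_display)
    (Omega : measurableType dsp) (P : probability Omega R)
    (F : R -> set_system Omega) (beta : R -> Omega -> R)
    (d : nat) (u0 : 'rV[R]_d -> R) (b g a f : R -> 'rV[R]_d -> R -> R)
    (Phi : R -> R -> R -> R) (T : R) (M : nat)
    (d_gt0 : (0 < d)%N)
    (HF : usual_conditions P F)
    (Hbeta : standard_brownian_motion P F beta)
    (Hu0_cont : {within cubeC d, continuous u0})
    (Hu0_bd : forall x, cube_bd d x -> u0 x = 0)
    (Hu0_range : forall x, cubeC d x -> -1 <= u0 x <= 1)
    (Hbg : coef_conditions b g)
    (Ha : sigma_factor b a)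
    (Hf : sigma_factor g f)
    (HPhi : integrator Phi)
    (T_gt0 : 0 < T)
    (M_gt0 : (0 < M)%N) :
  let tau := T / M%:R in
  let u := dplt a f Phi u0 tau beta in
  let E := [set w | forall m x, (m <= M)%N -> cubeC d x -> -1 <= u m w x <= 1] in
  [/\ {ae P, forall w, forall m, (m < M)%N ->
         dplt_step_well_defined a f Phi u0 tau beta m w},
      measurable E,
      P E = 1%E &
      forall m, (m <= M)%N -> {ae P, forall w, {within cubeC d, continuous (u m w)}}].
Proof.
move=> tau u E.
have tau0 : 0 < tau by rewrite divr_gt0 // ltr0n.
have [ca _] := Ha; have [cf _] := Hf.
(* The induction needs both properties at once: the range keeps the extended
   coefficients equal to the continuous ones, and continuity gives measurability
   of the next integrand. *)
have inv m w : {within cubeC d, continuous (u m w)} /\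
    forall x, cubeC d x -> -1 <= u m w x <= 1.
  elim: m => [|m [cm rm]]; first by split.
  by have [_ cS rS] := @splitting_step R d Omega a f Phi tau beta m w (u m w)
    tau0 ca cf HPhi cm rm.
have ET : E = setT by apply/seteqP; split => // w _ m x _; exact: (inv m w).2.
split.
- apply: aeW => w m _; have [cm rm] := inv m w; split.
    by move=> y /cubeOC Cy; exact: Zarg_in.
  by have [] := @splitting_step R d Omega a f Phi tau beta m w (u m w)
    tau0 ca cf HPhi cm rm.
- by rewrite ET.
- by rewrite ET probability_setT.
- by move=> m _; apply: aeW => w; exact: (inv m w).1.
Qed.
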